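(* Assume that $\vec{\nu}$ satisfies the regular variation condition with index $\alpha\in(0,1]$. Then for every integer $r\ge1$, $$\frac{r\,K_{n,r}}{K_{n,\overline{r}}}$$ is a strongly consistent estimator of $\alpha$, i.e. it converges to $\alpha$ almost surely as $n\to\infty$.
   Context: Let $(p_j)_{j\ge1}$ be a probability mass function on the positive integers, and let $U_1,U_2,\dots$ be i.i.d. with $\mathbb{P}(U_i=j)=p_j$. For sample size $n$, $X_{n,j}=\sum_{i=1}^n \mathbb{I}_{\{U_i=j\}}$, $K_{n,r}=\sum_{j\ge1}\mathbb{I}_{\{X_{n,j}=r\}}$ and $K_{n,\overline{r}}=\sum_{j\ge1}\mathbb{I}_{\{X_{n,j}\ge r\}}$. Counting function: $\vec{\nu}(x)=|\{j\ge1: p_j\ge x\}|$ for $x>0$. The regular variation condition with index $\alpha$ means $\vec{\nu}(1/x)\sim x^\alpha\ell(x)$ as $x\to\infty$ with $\ell$ slowly varying at infinity, i.e. $\lim_{\tau\to\infty}\ell(\tau x)/\ell(\tau)=1$ for all $x>0$. *)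

(* Defs.v *)
From HB Require Import structures.
From mathcomp Require Import all_boot all_order all_algebra.
From mathcomp Require Import finmap.
From mathcomp Require Import all_classical all_reals all_analysis.

Set Implicit Arguments.
Unset Strict Implicit.
Unset Printing Implicit Defensive.

Import Order.TTheory GRing.Theory Num.Theory.
Import numFieldNormedType.Exports.

Local Open Scope classical_set_scope.
Local Open Scope ring_scope.

(* Positive integers are the j : nat with 0 < j; p 0 is a junk value which no
   definition below reads. *)
Definition is_pmf (R : realType) (p : nat -> R) : Prop :=
  (forall j : nat, (0 < j)%N -> 0 <= p j) /\
  (\sum_(1 <= j <oo) (p j)%:E = 1)%E.

(* [counting] is +oo on infinite sets and [fine] would send that to 0; for a
   probability mass function the set is finite as soon as 0 < x. *)
Definition nu (R : realType) (p : nat -> R) (x : R) : R :=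
  fine (counting [set j : nat | (0 < j)%N /\ x <= p j]).

(* Since y / 0 = 0, the limits force l to be nonzero in a neighbourhood of
   +oo. *)
Definition slowly_varying (R : realType) (l : R -> R) : Prop :=
  forall x : R, 0 < x -> l (t * x) / l t @[t --> +oo] --> (1 : R).

(* nu(1/x) ~ x^alpha l(x) as x -> +oo is the convergence of the quotient to 1;
   the denominator is nonzero for x large, by the remark on l above. *)
Definition regular_variation (R : realType) (p : nat -> R) (alpha : R) : Prop :=
  exists2 l : R -> R, slowly_varying l &
    nu p (1 / x) / (x `^ alpha * l x) @[x --> +oo] --> (1 : R).

Definition mutually_independent (d d' : measure_display) (T : measurableType d)
    (T' : measurableType d') (R : realType) (P : probability T R)
    (U : nat -> T -> T') : Prop :=
  forall (J : {fset nat}) (A : nat -> set T'),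
    (forall i, measurable (A i)) ->
    P (\bigcap_(i in [set` J]) (U i @^-1` A i)) =
    (\prod_(i <- J) P (U i @^-1` A i))%E.

(* The sample U_1, U_2, ... of the text is U 0, U 1, ... here. *)
Definition iid_sample (d : measure_display) (T : measurableType d)
    (R : realType) (P : probability T R) (p : nat -> R)
    (U : nat -> {RV P >-> nat}) : Prop :=
  [/\ forall i w, (0 < U i w)%N,
      mutually_independent P (fun i => U i : T -> nat) &
      forall i j : nat, (0 < j)%N -> P (U i @^-1` [set j]) = (p j)%:E].

Definition occupancy (T : Type) (U : nat -> T -> nat) (n j : nat) (w : T) : nat :=
  (\sum_(i < n) (U i w == j))%N.

(* K_{n,r} and K_{n,\bar r}: both sums are finite when 0 < r, since at most n
   indices j have a nonzero occupancy. *)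
Definition K_eq (R : realType) (T : Type) (U : nat -> T -> nat) (n r : nat)
    (w : T) : R :=
  fine (\sum_(1 <= j <oo) ((occupancy U n j w == r)%:R : R)%:E)%E.

Definition K_ge (R : realType) (T : Type) (U : nat -> T -> nat) (n r : nat)
    (w : T) : R :=
  fine (\sum_(1 <= j <oo) ((r <= occupancy U n j w)%N%:R : R)%:E)%E.

(* Main.v *)
Require Import Defs.
From HB Require Import structures.
From mathcomp Require Import all_boot all_order all_algebra.
From mathcomp Require Import finmap.
From mathcomp Require Import all_classical all_reals all_analysis.
From mathcomp Require Import measurable_realfun.
From mathcomp Require Import ring lra.

Import Order.TTheory GRing.Theory Num.Theory.
Import numFieldNormedType.Exports.

Local Open Scope classical_set_scope.
Local Open Scope ring_scope.

(* Write [q j] for the probabilities, [a_r n] for the expectation of K_{n, \bar r} and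
   [Phi_r t = \sum_j Pr(Poisson (t * q j) >= r)] for its Poissonization.

   Occupancy counts are pairwise negatively correlated (an induction on the sample
   size), so the variance of K_{n, \bar r} is at most [a_r n].  As [a_r] and
   K_{n, \bar r} are nondecreasing in [n], and [a_r] grows by at most 1 at each step,
   Chebyshev along the times when [a_r] passes the squares gives
   K_{n, \bar r} / a_r n -> 1 almost surely.  Since r K_{n,r} / K_{n, \bar r} =
   r (1 - K_{n, \overline{r+1}} / K_{n, \bar r}), it remains to see that
   a_{r+1} n / a_r n -> 1 - alpha / r.

   Le Cam's bound gives a_r n ~ Phi_r n.  A layer-cake comparison transfers the regular
   variation of [nu] directly to [Phi_r], without Karamata's theorem: a scaling
   inequality for [nu] near 0 gives one for [Phi_r] up to a constant, and
   Phi_r -> oo.  This treats alpha < 1 and alpha = 1 alike.  Finally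
   t Phi_r'(t) = r (Phi_r(t) - Phi_{r+1}(t)), so a monotone density argument yields
   r (1 - Phi_{r+1} / Phi_r) -> alpha. *)

(** * Binomial and Poisson tails *)

(** This is Pr(Bin(n, p) >= a), by conditioning on one trial. The recursion has the shape of the
    conditioning on [U n] used for occupancy counts. *)
Fixpoint binom_tail (R : realType) (n a : nat) (p : R) : R :=
  match a, n with
  | 0, _ => 1
  | _.+1, 0 => 0
  | a'.+1, n'.+1 =>
      p * binom_tail R n' a' p + (1 - p) * binom_tail R n' a'.+1 p
  end.
Arguments binom_tail {R}.

(** This is Pr(Poisson(s) >= a), as 1 minus the first [a] point masses. *)
Fixpoint poisson_tail (R : realType) (a : nat) (s : R) : R :=
  if a is a'.+1 then poisson_tail R a' s - expR (- s) * (s ^+ a' / a'`!%:R)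
  else 1.
Arguments poisson_tail {R}.

Section BinomTail.
Context {R : realType}.
Implicit Types p q : R.

Lemma binom_tail0 n p : binom_tail n 0 p = 1.
Proof. by case: n. Qed.

Lemma binom_tailS n a p : binom_tail n.+1 a.+1 p =
  p * binom_tail n a p + (1 - p) * binom_tail n a.+1 p.
Proof. by []. Qed.

Lemma binom_tail_bounds n a p : 0 <= p <= 1 ->
  (0 <= binom_tail n a p <= 1) /\ binom_tail n a.+1 p <= binom_tail n a p.
Proof.
move=> p01; elim: n a => [|n IH] [|a].
- by split=> /=; lra.
- by split=> /=; lra.
- split; first by rewrite binom_tail0; lra.
  have [+ _] := IH 1%N; rewrite binom_tailS !binom_tail0 => h.
  nra.
- have [h0 h1] := IH a; have [h2 h3] := IH a.+1; have [h4 h5] := IH a.+2.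
  rewrite !binom_tailS; split; nra.
Qed.

Lemma binom_tail_ge0 n a p : 0 <= p <= 1 -> 0 <= binom_tail n a p.
Proof. by move=> /(binom_tail_bounds n a) [/andP[]]. Qed.

Lemma binom_tail_le1 n a p : 0 <= p <= 1 -> binom_tail n a p <= 1.
Proof. by move=> /(binom_tail_bounds n a) [/andP[]]. Qed.

Lemma binom_tail_anti n a p : 0 <= p <= 1 ->
  binom_tail n a.+1 p <= binom_tail n a p.
Proof. by move=> /(binom_tail_bounds n a) []. Qed.

(** One more trial adds [p] times the difference of two consecutive tails, which lies in [0, 1]. *)
Lemma binom_tail_incr n a p : 0 <= p <= 1 ->
  binom_tail n a p <= binom_tail n.+1 a p <= binom_tail n a p + p.
Proof.
case: a => [|a] p01; first by rewrite !binom_tail0; lra.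
have [h0 h1] := binom_tail_bounds n a _ p01.
have [h2 h3] := binom_tail_bounds n a.+1 _ p01.
rewrite binom_tailS; nra.
Qed.

Lemma binom_tail_le_mulrn n a p : 0 <= p <= 1 ->
  binom_tail n a.+1 p <= n%:R * p.
Proof.
move=> p01; elim: n => [|n IH]; first by rewrite /= mul0r.
have := binom_tail_incr n a.+1 p p01; rewrite -natr1; lra.
Qed.

Lemma binom_tail_homo n a p q : 0 <= p -> p <= q -> q <= 1 ->
  binom_tail n a p <= binom_tail n a q.
Proof.
move=> p0 pq q1; have q01 : 0 <= q <= 1 by lra.
elim: n a => [|n IH] [|a]; rewrite ?binom_tail0//.
rewrite !binom_tailS.
have := IH a; have := IH a.+1.
have [h2 h3] := binom_tail_bounds n a _ q01.
nra.
Qed.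

End BinomTail.

Section PoissonTail.
Context {R : realType}.
Implicit Types s u x : R.

Lemma poisson_tailS a s : poisson_tail a s - poisson_tail a.+1 s =
  expR (- s) * (s ^+ a / a`!%:R).
Proof. by rewrite /=; lra. Qed.

Lemma expRN_pow_le1 a s : 0 <= s -> 0 <= expR (- s) * (s ^+ a / a`!%:R) <= 1.
Proof.
move=> s0; apply/andP; split.
  by rewrite mulr_ge0 ?expR_ge0// divr_ge0// exprn_ge0.
rewrite expRN mulrC ler_pdivrMr ?expR_gt0// mul1r.
case: a => [|a].
  by rewrite expr0 fact0 divr1 -[leLHS]addr0 (le_trans _ (expR_ge1Dx _))// lerD.
by rewrite (le_trans _ (expR_ge1Dxn a s0))// lerDr.
Qed.

Lemma is_derive_pow_fact a s :
  is_derive s 1 (fun s => s ^+ a.+1 / a.+1`!%:R) (s ^+ a / a`!%:R).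
Proof.
have := is_deriveZ a.+1`!%:R^-1 (is_deriveX a.+1 (is_derive_id s 1)).
rewrite (_ : _ \*: _ = (fun s => s ^+ a.+1 / a.+1`!%:R)); last first.
  by apply/funext => x; rewrite /= exprfctE mulrC.
move=> /is_derive_eq; apply; rewrite -![_ *: _]/(_ * _) factS natrM /=.
have f0 : a`!%:R != 0 :> R by rewrite pnatr_eq0 -lt0n fact_gt0.
have a0 : a.+1%:R != 0 :> R by rewrite pnatr_eq0.
by rewrite -natr1 in a0 *; field; rewrite f0 a0.
Qed.

(** The derivative of a Poisson mass is the difference of two neighbouring masses, so the sum
    telescopes. *)
Lemma is_derive_poisson_tail a s :
  is_derive s 1 (poisson_tail a.+1) (expR (- s) * (s ^+ a / a`!%:R)).
Proof.
elim: a => [|a IH].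
  rewrite [poisson_tail _](_ : _ = (fun s => 1 - expR (- s))); last first.
    by apply/funext => x /=; rewrite expr0 fact0 divr1 mulr1.
  by apply: is_derive_eq; rewrite expr0 fact0; field.
have D : is_derive s 1 (fun s => expR (- s) * (s ^+ a.+1 / a.+1`!%:R))
    (expR (- s) * (s ^+ a / a`!%:R) - expR (- s) * (s ^+ a.+1 / a.+1`!%:R)).
  have DE : is_derive s 1 (fun s => expR (- s)) (- expR (- s)).
    by apply: is_derive_eq; ring.
  apply: is_derive_eq (is_deriveM DE (is_derive_pow_fact a s)) _.
  by rewrite -![_ *: _]/(_ * _) mulrN [_ * expR _]mulrC.
by apply: is_derive_eq (is_deriveB IH D) _; ring.
Qed.

Lemma is_derive_MVT (f df : R -> R) a b : a <= b ->
  (forall x, is_derive x 1 f (df x)) ->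
  exists2 c, a <= c <= b & f b - f a = df c * (b - a).
Proof.
move=> ab fdf; have cf : {within `[a, b], continuous f}.
  apply: continuous_subspaceT => x; apply: differentiable_continuous.
  by apply/derivable1_diffP; case: (fdf x).
have [c + ->] := MVT_segment ab (fun x _ => fdf x) cf.
by rewrite in_itv/= => ?; exists c.
Qed.

Lemma poisson_tail_MVT a s u : s <= u -> exists2 c, s <= c <= u &
  poisson_tail a.+1 u - poisson_tail a.+1 s =
  (poisson_tail a c - poisson_tail a.+1 c) * (u - s).
Proof.
move=> su; have [c scu ->] := is_derive_MVT _ _ _ _ su (is_derive_poisson_tail a).
by exists c => //; rewrite poisson_tailS.
Qed.

Lemma poisson_tail_lip a s u : 0 <= s <= u ->
  0 <= poisson_tail a u - poisson_tail a s <= u - s.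
Proof.
move=> /andP[s0 su]; case: a => [|a]; first by rewrite /= subrr; lra.
have [c /andP[sc cu] ->] := poisson_tail_MVT a _ _ su.
by have := expRN_pow_le1 a _ (le_trans s0 sc); rewrite -poisson_tailS; nra.
Qed.

Lemma poisson_tail_at0 a : poisson_tail a.+1 0 = 0 :> R.
Proof.
elim: a => [|a IH]; first by rewrite /= oppr0 expR0 expr0 fact0; lra.
by rewrite -[LHS]/(poisson_tail a.+1 0 - expR (- 0) * (0 ^+ a.+1 / _)) IH expr0n/=; lra.
Qed.

Lemma poisson_tail_ge0 a s : 0 <= s -> 0 <= poisson_tail a s.
Proof.
move=> s0; case: a => [//|a].
by have := @poisson_tail_lip a.+1 0 s; rewrite poisson_tail_at0 lexx s0; lra.
Qed.

Lemma poisson_tail_anti a s : 0 <= s -> poisson_tail a.+1 s <= poisson_tail a s.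
Proof.
by move=> s0; have := expRN_pow_le1 a _ s0; rewrite -poisson_tailS; lra.
Qed.

Lemma poisson_tail_le1 a s : 0 <= s -> poisson_tail a s <= 1.
Proof.
by move=> s0; elim: a => // a; apply: le_trans; exact: poisson_tail_anti.
Qed.

Lemma poisson_tail_le a s : 0 <= s -> poisson_tail a.+1 s <= s.
Proof.
by move=> s0; have := @poisson_tail_lip a.+1 0 s; rewrite poisson_tail_at0 lexx s0; lra.
Qed.

Lemma poisson_tail_homo a s u : 0 <= s -> s <= u ->
  poisson_tail a s <= poisson_tail a u.
Proof.
by move=> s0 su; have := @poisson_tail_lip a s u; rewrite s0 su; lra.
Qed.

Lemma poisson_tail_near1 a (e : R) : 0 < e ->
  exists2 M, 0 < M & 1 - e <= poisson_tail a M.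
Proof.
elim: a e => [|a IH] e e0; first by exists 1 => //=; lra.
have [M M0 hM] := IH (e / 2) ltac:(lra).
(* As exp(M') >= M'^(a+1) / (a+1)!, the mass at [a] is at most (a+1) / M', hence at most e / 2 by
   this choice. *)
pose M' := Num.max M (2 * a.+1%:R / e).
have MM' : M <= M' by rewrite le_max lexx.
have M'0 : 0 < M' by lra.
exists M' => //.
have hM' := poisson_tail_homo a _ _ (ltW M0) MM'.
have : expR (- M') * (M' ^+ a / a`!%:R) <= e / 2.
  rewrite expRN mulrC ler_pdivrMr ?expR_gt0//.
  have := expR_ge1Dxn a (ltW M'0).
  rewrite factS natrM exprS.
  set f := a`!%:R; set t := M' ^+ a.
  have f0 : 0 < f by rewrite ltr0n fact_gt0.
  have t0 : 0 < t by rewrite exprn_gt0.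
  have -> : M' * t / (a.+1%:R * f) = (M' / a.+1%:R) * (t / f).
    by rewrite -natr1; field; rewrite natr1 !gt_eqF.
  have h : 2 / e <= M' / a.+1%:R.
    rewrite ler_pdivlMr ?ltr0n// le_max; apply/orP; right.
    by rewrite mulrAC.
  move: h; rewrite ler_pdivrMr// => h.
  have tf : 0 < t / f by rewrite divr_gt0.
  move: (t / f) tf h => y y0 h.
  move: (M' / a.+1%:R) h => x h hy.
  have {}h : 2 * y <= x * e * y by rewrite ler_pM2r.
  nra.
rewrite -poisson_tailS; lra.
Qed.

(* The left side minus the right side, as a function of [l], has derivative of the sign
   of [1 - l], hence is maximal at [l = 1]. *)
Lemma poisson_tail_scale a s l : 0 <= s -> 0 < l ->
  poisson_tail a.+1 (l * s) <= poisson_tail a.+1 s +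
    (poisson_tail a.+1 s - poisson_tail a.+2 s) * (l ^+ a.+1 - 1).
Proof.
move=> s0 l0; rewrite poisson_tailS.
set E := expR (- s).
(* Up to a constant, [F] is the difference of the two sides in the variable u = l * s; for u >= 0,
   [dF] vanishes or has the sign of s - u. *)
pose F u := poisson_tail a.+1 u - E * (u ^+ a.+1 / a.+1`!%:R).
pose dF u := expR (- u) * (u ^+ a / a`!%:R) - E * (u ^+ a / a`!%:R).
have FdF u : is_derive u 1 F (dF u).
  exact: is_deriveB (is_derive_poisson_tail a u)
                    (is_deriveZ E (is_derive_pow_fact a u)).
have F1 : F (l * s) - F s = poisson_tail a.+1 (l * s) - poisson_tail a.+1 s
    - E * (s ^+ a.+1 / a.+1`!%:R) * (l ^+ a.+1 - 1).
  by rewrite /F exprMn; ring.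
suff : F (l * s) - F s <= 0 by rewrite F1; lra.
have dFE u : dF u = (expR (- u) - E) * (u ^+ a / a`!%:R).
  by rewrite /dF mulrBl.
have pos u : 0 <= u -> 0 <= u ^+ a / a`!%:R.
  by move=> u0; rewrite divr_ge0// exprn_ge0.
have [l1|l1] := leP 1 l.
  have sl : s <= l * s by nra.
  have [c /andP[sc cu] ->] := is_derive_MVT _ _ _ _ sl FdF.
  rewrite dFE; have := pos _ (le_trans s0 sc).
  have : expR (- c) <= E by rewrite ler_expR lerN2.
  by move=> h1 h2; rewrite mulr_le0_ge0 ?subr_ge0// mulr_le0_ge0 ?subr_le0.
have sl : l * s <= s by nra.
have [c /andP[sc cu] h] := is_derive_MVT _ _ _ _ sl FdF.
rewrite -opprB h dFE oppr_le0.
have c0 : 0 <= c by apply: le_trans sc; nra.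
have : E <= expR (- c) by rewrite ler_expR lerN2.
by move=> h1; apply: mulr_ge0; [apply: mulr_ge0; rewrite ?subr_ge0 ?pos|rewrite subr_ge0].
Qed.

(** Le Cam's bound: each trial costs p^2. By the mean value theorem, raising the Poisson parameter
    from s to s + p acts like a Bernoulli trial, except that the mass is taken at a point [c] of
    [s, s + p]; the Lipschitz bound moves [c] back to s. *)
Lemma binom_poisson_tail n a (p : R) : 0 <= p <= 1 ->
  `|binom_tail n a p - poisson_tail a (n%:R * p)| <= n%:R * p ^+ 2.
Proof.
move=> p01; elim: n a => [|n IH] [|a].
- by rewrite /= subrr normr0 mul0r.
- by rewrite mul0r poisson_tail_at0 /= subrr normr0 mul0r.
- by rewrite binom_tail0 /= subrr normr0 mulr_ge0 ?exprn_ge0//; lra.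
rewrite binom_tailS.
have nS x : n.+1%:R * x = n%:R * x + x :> R by rewrite -natr1; ring.
rewrite !nS.
have s0 : 0 <= n%:R * p by rewrite mulr_ge0//; lra.
move: (n%:R * p) s0 (IH a) (IH a.+1) => s s0 IH0 IH1.
have su : 0 <= s <= s + p by lra.
have [c sc hc] := poisson_tail_MVT a s (s + p) ltac:(lra).
have l0 := @poisson_tail_lip a s c; have l1 := @poisson_tail_lip a.+1 s c.
have sc' : 0 <= s <= c by lra.
move: hc IH0 IH1 (l0 sc') (l1 sc').
move: (poisson_tail a c) (poisson_tail a.+1 c) (poisson_tail a s)
  (poisson_tail a.+1 s) (poisson_tail a.+1 (s + p))
  (binom_tail n a p) (binom_tail n a.+1 p) => x1 x2 x3 x4 x5 x6 x7.
move=> h1; rewrite !ler_norml => h2 h3 h4 h5.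
have h6 : -p <= (x1 - x3) - (x2 - x4) <= p by lra.
have {}h1 : x5 = x4 + p * (x1 - x2) by lra.
have h7 : x5 - x4 - p * (x3 - x4) = p * ((x1 - x3) - (x2 - x4)) by lra.
move: ((x1 - x3) - (x2 - x4)) h6 h7 => y h6 h7.
have h8: p * y <= p ^+ 2 by rewrite expr2; nra.
have h9: - p ^+ 2 <= p * y by rewrite expr2; nra.
have h10 : p * x6 + (1 - p) * x7 - x5 =
    p * (x6 - x3) + (1 - p) * (x7 - x4) - p * y by lra.
rewrite h10; nra.
Qed.

End PoissonTail.

(** * Sums of nonnegative series *)

(** Real-valued, so that linear arithmetic applies; [fine] sends a divergent series to 0, so the
    value is meaningful only under [nnsummable]. *)
Definition sumR (R : realType) (f : nat -> R) : R :=
  fine (\sum_(j <oo) (f j)%:E)%E.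
Arguments sumR {R}.

Definition nnsummable (R : realType) (f : nat -> R) : Prop :=
  (forall j, 0 <= f j) /\ (\sum_(j <oo) (f j)%:E < +oo)%E.
Arguments nnsummable {R}.

Section SumR.
Context {R : realType}.
Implicit Types f g : nat -> R.

Lemma sumRE f : nnsummable f -> (sumR f)%:E = (\sum_(j <oo) (f j)%:E)%E.
Proof.
move=> [f0 ffin]; rewrite fineK// ge0_fin_numE//.
by apply: nneseries_ge0 => j _ _; rewrite lee_fin.
Qed.

Lemma sumR_ge0 f : nnsummable f -> 0 <= sumR f.
Proof.
move=> sf; rewrite -lee_fin sumRE//.
by apply: nneseries_ge0 => j _ _; rewrite lee_fin sf.1.
Qed.

Lemma nnsummable_le f g : (forall j, 0 <= f j <= g j) -> nnsummable g ->
  nnsummable f.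
Proof.
move=> fg [g0 gfin]; split; first by move=> j; case/andP: (fg j).
by apply: le_lt_trans gfin; apply: lee_nneseries => j *; rewrite lee_fin;
   case/andP: (fg j).
Qed.

Lemma sumR_le f g : nnsummable f -> nnsummable g -> (forall j, f j <= g j) ->
  sumR f <= sumR g.
Proof.
move=> sf sg fg; rewrite -lee_fin !sumRE//; apply: lee_nneseries => j *.
  by rewrite lee_fin sf.1.
by rewrite lee_fin.
Qed.

Lemma nnsummableD f g : nnsummable f -> nnsummable g ->
  nnsummable (fun j => f j + g j).
Proof.
move=> [f0 sf] [g0 sg]; split; first by move=> j; rewrite addr_ge0.
under eq_eseriesr do rewrite EFinD.
rewrite nneseriesD; first by rewrite lte_add_pinfty.
- by move=> j *; rewrite lee_fin.
- by move=> j *; rewrite lee_fin.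
Qed.

Lemma sumRD f g : nnsummable f -> nnsummable g ->
  sumR (fun j => f j + g j) = sumR f + sumR g.
Proof.
move=> sf sg; apply: EFin_inj; rewrite EFinD !sumRE//; last exact: nnsummableD.
under eq_eseriesr do rewrite EFinD.
by rewrite nneseriesD// => j *; rewrite lee_fin; [apply sf.1|apply sg.1].
Qed.

Lemma nnsummableZ (c : R) f : 0 <= c -> nnsummable f ->
  nnsummable (fun j => c * f j).
Proof.
move=> c0 sf; split; first by move=> j; rewrite mulr_ge0// sf.1.
under eq_eseriesr do rewrite EFinM.
rewrite nneseriesZl; last by move=> j _; rewrite lee_fin sf.1.
by rewrite -sumRE// -EFinM ltry.
Qed.

Lemma sumRZ (c : R) f : 0 <= c -> nnsummable f ->
  sumR (fun j => c * f j) = c * sumR f.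
Proof.
move=> c0 sf; apply: EFin_inj; rewrite EFinM !sumRE//; last exact: nnsummableZ.
under eq_eseriesr do rewrite EFinM.
by rewrite nneseriesZl// => j _; rewrite lee_fin sf.1.
Qed.

Lemma nnsummable_cvg0 f : nnsummable f -> f @ \oo --> 0.
Proof.
move=> [f0 sf]; apply: cvg_series_cvg_0.
exact: nnseries_is_cvg.
Qed.

Lemma nnsummable_near_lt f (e : R) : nnsummable f -> 0 < e ->
  exists N, forall j, (N <= j)%N -> f j < e.
Proof.
move=> sf e0; have /cvgrPdist_lt/(_ _ e0)[N _ hN] := nnsummable_cvg0 f sf.
exists N => j /hN /=; rewrite sub0r normrN ger0_norm//; exact: sf.1.
Qed.

End SumR.

(** * Layer-cake comparison *)

(** The counting function as a series of indicators, the form in which it is compared with other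
    sums over j. *)
Definition tail_count (R : realType) (q : nat -> R) (x : R) : R :=
  sumR (fun j => (x <= q j)%R%:R : R).
Arguments tail_count {R}.

Lemma ler_bool (R : numDomainType) (a b : bool) :
  (a -> b) -> a%:R <= b%:R :> R.
Proof. by case: a; case: b => //= /(_ isT). Qed.

Section LayerCake.
Context {R : realType} (q : nat -> R).
Hypothesis sq : nnsummable q.

(** Markov's inequality: the indicator is dominated by C * f. *)
Lemma nnsummable_indic (C : R) (f : nat -> R) (P : pred nat) : nnsummable f ->
  0 <= C -> (forall j, P j -> 1 <= C * f j) -> nnsummable (fun j => (P j)%:R : R).
Proof.
move=> sf C0 hP; apply: (nnsummable_le _ (fun j => C * f j)).
  move=> j; have := hP j; case: (P j) => /= [->//|_].
    by rewrite ler01.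
  by rewrite lexx mulr_ge0// sf.1.
exact: nnsummableZ.
Qed.

Lemma nnsummable_tail (x : R) : 0 < x -> nnsummable (fun j => (x <= q j)%R%:R : R).
Proof.
move=> x0; apply: (nnsummable_indic x^-1 q) => //; first by rewrite invr_ge0 ltW.
by move=> j h; rewrite mulrC ler_pdivlMr// mul1r.
Qed.

Lemma tail_count_homo (x y : R) : 0 < x -> x <= y ->
  tail_count q y <= tail_count q x.
Proof.
move=> x0 xy; apply: sumR_le; [apply: nnsummable_tail; exact: lt_le_trans xy|
  exact: nnsummable_tail|].
by move=> j; apply: ler_bool => /(le_trans xy).
Qed.

Variables (h : R -> R) (C : R).
Hypothesis h_homo : forall s u, 0 <= s -> s <= u -> h s <= h u.
Hypothesis h_le1 : forall s, 0 <= s -> 0 <= h s <= 1.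
Hypothesis C0 : 0 < C.
Hypothesis h_leC : forall s, 0 <= s -> h s <= C * s.

Lemma nnsummable_layer (l y : R) : 0 < l -> 0 < y ->
  nnsummable (fun j => (y < h (l * q j))%R%:R : R).
Proof.
move=> l0 y0; apply: (nnsummable_indic (C * l / y) q) => //.
  by rewrite ltW// divr_gt0// mulr_gt0.
move=> j yh; rewrite mulrAC ler_pdivlMr// mul1r -mulrA (le_trans (ltW yh))//.
by apply: h_leC; rewrite mulr_ge0 ?sq.1// ltW.
Qed.

Lemma integral_layer (b : R) : 0 <= b <= 1 ->
  (\int[lebesgue_measure]_(y in `]0%R, 1%R]) ((y < b)%R%:R : R)%:E = b%:E)%E.
Proof.
move=> b01.
transitivity (\int[lebesgue_measure]_(y in `]0%R, 1%R]) (\1_`]-oo, b[ y)%:E)%E.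
  apply: eq_integral => y _; congr EFin; rewrite indicE; congr (_%:R).
  by rewrite mem_setE in_itv.
rewrite integral_indic//.
rewrite (_ : _ `&` _ = `]0, b[%classic); last first.
  apply/seteqP; split => y /=; rewrite !in_itv/=; first by move=> [-> /andP[->]].
  by move=> /andP[-> yb]; split => //; apply: ltW; lra.
transitivity (lebesgue_measure ([set` `]0, b[] : set R)) => //.
rewrite lebesgue_measure_itv/= lte_fin; case: ltP => h0; first by rewrite sube0.
by congr EFin; lra.
Qed.

Lemma sum_layer (l : R) : 0 < l ->
  (\sum_(j <oo) (h (l * q j))%:E =
  \int[lebesgue_measure]_(y in `]0%R, 1%R])
    \sum_(j <oo) ((y < h (l * q j))%R%:R : R)%:E)%E.
Proof.
move=> l0; rewrite integral_nneseries//.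
- apply: eq_eseriesr => j _; rewrite integral_layer//.
  by apply: h_le1; rewrite mulr_ge0 ?sq.1// ltW.
- move=> j; apply/measurable_EFinP.
  rewrite (_ : (fun _ => _) = \1_`]-oo, (h (l * q j))[); first exact: measurable_indic.
  by apply/funext => y; rewrite indicE mem_setE in_itv.
Qed.

Variables (l c delta : R).
Hypotheses (l0 : 0 < l) (c0 : 0 <= c) (delta0 : 0 < delta).
Hypothesis hc : forall x, 0 < x -> x <= delta ->
  c * tail_count q x <= tail_count q (x / l).

(** Since q tends to 0, only finitely many j satisfy y < h (q j); let x be the smallest such q j.
    The set lies in {q >= x}, while by monotonicity q j >= x / l implies y < h (l * q j), so [hc] at
    x concludes if x <= delta. If x > delta, the count is at most [tail_count q delta]. *)
Lemma layer_le (y : R) : 0 < y ->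
  c * sumR (fun j => (y < h (q j))%R%:R : R) <=
  sumR (fun j => (y < h (l * q j))%R%:R : R) + c * tail_count q delta.
Proof.
move=> y0.
have sl := nnsummable_layer l y l0 y0.
have s1 : nnsummable (fun j => (y < h (q j))%R%:R : R).
  have := nnsummable_layer 1 y ltr01 y0.
  by under eq_fun do rewrite mul1r.
have [[i1 hi1]|no] := pselect (exists i, y < h (q i)); last first.
  have -> : sumR (fun j => (y < h (q j))%R%:R : R) = 0.
    rewrite /sumR eseries0//= => i _ _; case: ltP => // ?.
    by case: no; exists i.
  rewrite mulr0 addr_ge0 ?sumR_ge0// mulr_ge0// sumR_ge0//.
  exact: nnsummable_tail.
have yC : 0 < y / C by rewrite divr_gt0.
have [N hN] := nnsummable_near_lt q _ sq yC.
have AN j : y < h (q j) -> (j < N)%N.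
  move=> hj; rewrite ltnNge; apply/negP => /hN.
  rewrite ltr_pdivlMr// mulrC => hq.
  by have := h_leC _ (sq.1 j); lra.
have [i2 /= hi2 min] := @arg_minP _ _ _ (Ordinal (AN _ hi1))
  (fun i : 'I_N => y < h (q i)) (fun i : 'I_N => q i) hi1.
set x := q i2 in hi2 min.
have x0 : 0 < x.
  rewrite lt_neqAle sq.1 andbT; apply/negP => /eqP xE.
  by have := h_leC x (sq.1 _); rewrite -xE mulr0; move: hi2; rewrite -xE; lra.
have N1 : sumR (fun j => (y < h (q j))%R%:R : R) <= tail_count q x.
  apply: sumR_le => //; first exact: nnsummable_tail.
  move=> j; apply: ler_bool => hj.
  exact: (min (Ordinal (AN _ hj))).
have N2 : tail_count q (x / l) <= sumR (fun j => (y < h (l * q j))%R%:R : R).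
  apply: sumR_le => //; first by apply: nnsummable_tail; exact: divr_gt0.
  move=> j; apply: ler_bool => hj.
  apply: (lt_le_trans hi2); apply: h_homo; first exact: ltW.
  by rewrite mulrC -ler_pdivrMr.
apply: (le_trans (ler_wpM2l c0 N1)).
have [xd|xd] := leP x delta.
  apply: (le_trans (hc _ x0 xd)); apply: (le_trans N2).
  by rewrite lerDl mulr_ge0// sumR_ge0//; exact: nnsummable_tail.
apply: le_trans (ler_wpM2l c0 (tail_count_homo _ _ delta0 (ltW xd))) _.
by rewrite lerDr sumR_ge0.
Qed.

(** [layer_le] integrated over the levels y in ]0, 1], with Tonelli's theorem for the series. The
    error term does not depend on [h]; this matters because [h] will be a Poisson tail rescaled by
    n, with n tending to infinity. *)
Lemma layer_cake_le :
  c * sumR (fun j => h (q j)) <=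
  sumR (fun j => h (l * q j)) + c * tail_count q delta.
Proof.
have sh k : 0 < k -> nnsummable (fun j => h (k * q j)).
  move=> k0; apply: (nnsummable_le _ (fun j => C * k * q j)).
    move=> j; have kq : 0 <= k * q j by rewrite mulr_ge0 ?sq.1// ltW.
    by rewrite -mulrA h_leC// andbT; case/andP: (h_le1 _ kq).
  by apply: nnsummableZ => //; rewrite mulr_ge0// ltW.
have s1 := sh 1 ltr01.
have E1 : (fun j => h (q j)) = (fun j => h (1 * q j)).
  by apply/funext => j; rewrite mul1r.
rewrite E1 -lee_fin EFinD EFinM !sumRE//; last exact: sh.
rewrite !sum_layer//.
have mD : measurable (`]0%R, 1%R]%classic : set R) by exact: measurable_itv.
have mf k : 0 < k -> measurable_fun (`]0%R, 1%R]%classic : set R)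
   (fun y => \sum_(j <oo) ((y < h (k * q j))%R%:R : R)%:E)%E.
  move=> k0; apply: ge0_emeasurable_sum; first by move=> *; rewrite lee_fin.
  move=> j _; apply/measurable_EFinP.
  rewrite (_ : (fun _ => _) = \1_`]-oo, (h (k * q j))[); first exact: measurable_indic.
  by apply/funext => y; rewrite indicE mem_setE in_itv.
have f0 k y : (0 <= \sum_(j <oo) ((y < h (k * q j))%R%:R : R)%:E)%E.
  by apply: nneseries_ge0 => *; rewrite lee_fin.
have cN : 0 <= c * tail_count q delta.
  by rewrite mulr_ge0// sumR_ge0//; exact: nnsummable_tail.
have -> : (c * tail_count q delta)%:E = (\int[lebesgue_measure]_(y in `]0%R, 1%R])
    (cst (c * tail_count q delta)%:E y))%E.
  rewrite integral_cst//; transitivity ((c * tail_count q delta)%:E *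
    lebesgue_measure ([set` `]0%R, 1%R]] : set R))%E => //.
  by rewrite lebesgue_measure_itv/= lte_fin ltr01 sube0 mule1.
rewrite -ge0_integralZl//; last exact: mf.
rewrite -ge0_integralD//; last exact: mf.
apply: ge0_le_integral => //.
- by move=> y _; rewrite mule_ge0.
- by apply: measurable_funeM; exact: mf.
- by apply: emeasurable_funD => //; exact: mf.
move=> y /=; rewrite in_itv/= => /andP[y0 _].
rewrite -!sumRE; [|exact: nnsummable_layer..].
rewrite -EFinM -EFinD lee_fin.
have := layer_le y y0.
by under [X in _ * sumR X]eq_fun do rewrite -[q _]mul1r.
Qed.

End LayerCake.

(** * Regular variation *)

Section RegularVariation.
Context {R : realType}.

Lemma nneseries_shift1 (f : nat -> \bar R) :
  (forall j, (0 < j)%N -> (0 <= f j)%E) ->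
  (\sum_(1 <= j <oo) f j = \sum_(j <oo) f j.+1)%E.
Proof.
(* The value [f 0] may be negative, so it is replaced by 0 before using results on nonnegative
   series. *)
move=> f0; pose g j := if j is 0%N then 0%E else f j.
have g0 j : (0 <= g j)%E by case: j => //= j; exact: f0.
transitivity (\sum_(1 <= j <oo) g j)%E.
  rewrite eseries_cond [RHS]eseries_cond.
  by apply: eq_eseriesr => -[].
rewrite -nneseries_addn//; apply: eq_eseriesr => j _.
by rewrite addn1.
Qed.

Lemma nu_tail_count (p : nat -> R) (x : R) :
  nu p x = tail_count (fun j => p j.+1) x.
Proof.
rewrite /nu /tail_count /sumR; congr fine.
set A := [set j | _].
have -> : counting A = (\sum_(j <oo) (\1_A j : R)%:E)%E.
  rewrite -(@ge0_integral_count R (fun j => (\1_A j)%:E))//.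
  by rewrite integral_indic// setIT.
rewrite (nneseries_split 0 1)// add0n big_nat1 indicE memNset; last by case.
rewrite [X in (X + _)%E](_ : _ = 0%E)// add0e.
rewrite nneseries_shift1//; apply: eq_eseriesr => j _.
rewrite indicE; congr ((nat_of_bool _)%:R%:E).
by apply/idP/idP => [/set_mem[]//|h]; apply/mem_set.
Qed.

Variables (p : nat -> R) (alpha : R).
Hypothesis alpha0 : 0 < alpha.
Hypothesis rv : regular_variation p alpha.

Lemma nu_ratio_cvg (l : R) : 0 < l ->
  nu p (1 / (l * x)) / nu p (1 / x) @[x --> +oo] --> l `^ alpha.
Proof.
move=> l0; case: rv => L slow.
set A := fun x => nu p (1 / x) / (x `^ alpha * L x) => A1.
have Al : A (l * x) @[x --> +oo] --> (1 : R).
  apply: (cvg_comp (fun x => l * x) A _ A1).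
  exact: gt0_cvgMry.
have Ll := slow l l0.
(* The slowly varying factor enters only through the quotient L (l x) / L x, which tends to 1. *)
have H : A (l * x) * (L (x * l) / L x) * l `^ alpha / A x
    @[x --> +oo] --> 1 * 1 * l `^ alpha / 1.
  apply: cvgM; last by apply: cvgV => //; rewrite oner_eq0.
  by apply: cvgM; [exact: cvgM|exact: cvg_cst].
rewrite invr1 !mulr1 mul1r in H.
apply: cvg_trans H; apply: near_eq_cvg; near=> x.
have x0 : 0 < x by near: x; exact: nbhs_pinfty_gt.
(* Division by 0 gives 0, so a quotient that is positive near its limit 1 has nonzero numerator and
   denominator. *)
have Lx : L (x * l) / L x > 0 by near: x; apply: (cvgr_gt _ Ll); exact: ltr01.
have Ax : A x > 0 by near: x; apply: (cvgr_gt _ A1); exact: ltr01.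
have L0 : L x != 0 by apply: contraTneq Lx => ->; rewrite invr0 mulr0 ltxx.
have L1 : L (x * l) != 0 by apply: contraTneq Lx => ->; rewrite mul0r ltxx.
have N0 : nu p (1 / x) != 0.
  by apply: contraTneq Ax => AE; rewrite /A AE mul0r ltxx.
rewrite /A powRM ?ltW// [x * l]mulrC in L1 *.
have xa : x `^ alpha != 0 by rewrite gt_eqF// powR_gt0.
have la : l `^ alpha != 0 by rewrite gt_eqF// powR_gt0.
by field; rewrite N0 L0 xa L1 la.
Unshelve. all: by end_near. Qed.

Let q j := p j.+1.
Hypothesis sq : nnsummable q.

(** One-sided form of regular variation near 0, which is what the layer-cake comparison takes as
    input. The count is positive since a zero denominator would make the quotient 0, not greater
    than c >= 0. *)
Lemma tail_count_scale (l c : R) : 0 < l -> 0 <= c -> c < l `^ alpha ->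
  exists2 delta, 0 < delta & forall x, 0 < x -> x <= delta ->
    0 < tail_count q x /\ c * tail_count q x <= tail_count q (x / l).
Proof.
move=> l0 c0 cl; have := cvgr_gt _ (nu_ratio_cvg l l0) c cl.
(* This bound on x ensures that 1 / x exceeds the threshold [M]. *)
move=> [M [_ hM]]; exists (`|M| + 1)^-1; first by rewrite invr_gt0 ltr_wpDl.
move=> x x0 xd.
have MX : M < x^-1.
  rewrite (@lt_le_trans _ _ (`|M| + 1))//.
    by rewrite (le_lt_trans (ler_norm M))// ltrDl.
  by rewrite -[leLHS]invrK lef_pV2// posrE invr_gt0 ltr_wpDl.
have := hM _ MX; rewrite /= !nu_tail_count -/q.
have -> : 1 / x^-1 = x by rewrite div1r invrK.
have -> : 1 / (l * x^-1) = x / l by rewrite div1r invfM invrK mulrC.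
have : 0 <= tail_count q x by apply: sumR_ge0; exact: nnsummable_tail.
rewrite le_eqVlt => /predU1P[<-|N0 h]; first by rewrite invr0 mulr0 => ?; lra.
by split => //; rewrite -ler_pdivlMr// ltW.
Qed.

(** As 2^alpha > 1, scaling with l = 2 and c = (1 + 2^alpha) / 2 > 1 makes each halving of x add at
    least (c - 1) * tail_count q d to the count. *)
Lemma tail_count_unbounded (M : R) : exists2 x, 0 < x & M <= tail_count q x.
Proof.
have h2 : 1 < 2 `^ alpha :> R.
  have := @gt0_ltr_powR R alpha alpha0 1 2; rewrite powR1; apply; rewrite ?nnegrE //; lra.
have [d d0 hd] := @tail_count_scale 2 ((1 + 2 `^ alpha) / 2)
  ltac:(lra) ltac:(lra) ltac:(lra).
move: (2 `^ alpha) h2 hd => k k1 hd.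
have [N0 _] := hd d d0 (lexx _).
have claim n : exists2 x, 0 < x <= d &
    tail_count q d * (1 + n%:R * ((k - 1) / 2)) <= tail_count q x.
  elim: n => [|n [x /andP[x0 xd] IH]].
    by exists d; rewrite ?d0 ?lexx// mul0r addr0 mulr1.
  exists (x / 2); first by apply/andP; split; lra.
  have [_] := hd x x0 xd.
  have := tail_count_homo _ sq _ _ x0 xd.
  move=> h1 h2; have : (k - 1) / 2 * tail_count q d <= (k - 1) / 2 * tail_count q x.
    by rewrite ler_wpM2l//; lra.
  have -> : tail_count q d * (1 + n.+1%:R * ((k - 1) / 2)) =
     tail_count q d * (1 + n%:R * ((k - 1) / 2)) + (k - 1) / 2 * tail_count q d.
    by rewrite -natr1; ring.
  lra.
pose e := tail_count q d * ((k - 1) / 2).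
have e0 : 0 < e by rewrite mulr_gt0//; lra.
have [x /andP[x0 _] hx] := claim (Num.bound `|M / e|).
exists x => //; apply: le_trans hx; rewrite mulrDr mulr1 mulrCA -/e.
have : M / e < (Num.bound `|M / e|)%:R.
  by rewrite (le_lt_trans (ler_norm _))// archi_boundP.
by rewrite ltr_pdivrMr// => ?; lra.
Qed.

End RegularVariation.

(** * Monotone density argument *)

Section MonotoneDensity.
Context {R : realType}.

(* With [x n = t f'(t) / (m f(t))] at [t = n], the hypothesis is regular variation of [f]
   with index [a], weakened by the monotonicity of [f'(t) / t ^+ m.-1]. *)
Lemma monotone_density (x : nat -> R) (a : R) (m : nat) : 0 < a -> (0 < m)%N ->
  (forall u eta, 0 < eta -> \forall n \near \oo,
     expR (a * u) - eta <= 1 + x n * (expR u ^+ m - 1)) ->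
  m%:R * x n @[n --> \oo] --> a.
Proof.
move=> a0 m0 hx; apply/cvgrPdist_le => e e0.
(* The hypothesis is used at u = v / m and u = - v / m with eta = v^2 / m. The first two bounds on
   [v] keep a - v and 1 - v positive; the third makes the final error v * (a + 2) at most e. *)
pose v := Num.min (1 / 2) (Num.min (a / 2) (e / (a + 2))).
have a2 : 0 < a + 2 by lra.
have v0 : 0 < v by rewrite !lt_min !divr_gt0.
have v1 : v <= 1 / 2 by rewrite ge_min lexx.
have va : v <= a / 2 by rewrite !ge_min lexx orbT.
have ve : v * (a + 2) <= e by rewrite -ler_pdivlMr// !ge_min lexx !orbT.
have mR : 0 < m%:R :> R by rewrite ltr0n.
have eta0 : 0 < v ^+ 2 / m%:R by rewrite divr_gt0// exprn_gt0.
near=> n.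
have : expR (a * (v / m%:R)) - v ^+ 2 / m%:R <=
    1 + x n * (expR (v / m%:R) ^+ m - 1).
  by near: n; exact: hx.
have : expR (a * - (v / m%:R)) - v ^+ 2 / m%:R <=
    1 + x n * (expR (- (v / m%:R)) ^+ m - 1).
  by near: n; exact: hx.
have mv : m%:R * (v / m%:R) = v by field; rewrite gt_eqF.
rewrite -!expRM_natl !mulrN mv.
have := expR_ge1Dx (a * (v / m%:R)); have := expR_ge1Dx (- (a * (v / m%:R))).
have h1 := expR_ge1Dx v; have h2 := expR_ge1Dx (- v).
have := expRxMexpNx_1 v; have := expR_gt0 v; have := expR_gt0 (- v).
move: (expR v) (expR (- v)) h1 h2 => E F h1 h2 F0 E0 EF.
move: (expR _) (expR _) => G H h3 h4 h5 h6.
set y := m%:R * x n.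
(* The positive u gives the lower bound [h7] on y = m * x n, the negative u the upper bound [h8]. *)
have xE : x n = y / m%:R by rewrite /y mulrC mulKf// gt_eqF.
have h7 : v * (a - v) <= y * (E - 1).
  have : v * (a - v) / m%:R <= y * (E - 1) / m%:R.
    rewrite [y * _ / _]mulrAC -xE.
    have -> : v * (a - v) / m%:R = a * (v / m%:R) - v ^+ 2 / m%:R by ring.
    lra.
  by rewrite ler_pM2r// invr_gt0.
have h8 : y * (1 - F) <= v * (a + v).
  have : y * (1 - F) / m%:R <= v * (a + v) / m%:R.
    rewrite [y * _ / _]mulrAC -xE.
    have -> : v * (a + v) / m%:R = a * (v / m%:R) + v ^+ 2 / m%:R by ring.
    lra.
  by rewrite ler_pM2r// invr_gt0.
(* These are exp(v) <= 1 / (1 - v) and exp(-v) <= 1 / (1 + v), from 1 + z <= exp(z) at z = -v and z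
   = v. *)
have E1 : E * (1 - v) <= 1 by rewrite -EF ler_pM2l//; lra.
have F1 : F * (1 + v) <= 1 by rewrite -EF mulrC ler_pM2r//; lra.
have EE : (E - 1) * (1 - v) <= v by lra.
have FF : v <= (1 - F) * (1 + v) by lra.
have y0 : 0 < y.
  rewrite -(pmulr_lgt0 _ (x := E - 1)); last lra.
  by apply: lt_le_trans h7; rewrite mulr_gt0//; lra.
have h9 : (a - v) * (1 - v) <= y.
  rewrite -(ler_pM2l v0).
  have : v * (a - v) * (1 - v) <= y * (E - 1) * (1 - v) by rewrite ler_pM2r//; lra.
  have : y * ((E - 1) * (1 - v)) <= y * v by rewrite ler_pM2l.
  lra.
have h10 : y <= (a + v) * (1 + v).
  rewrite -(ler_pM2l v0).
  have : y * (1 - F) * (1 + v) <= v * (a + v) * (1 + v) by rewrite ler_pM2r//; lra.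
  have : y * v <= y * ((1 - F) * (1 + v)) by rewrite ler_pM2l.
  lra.
rewrite ler_norml; nra.
Unshelve. all: by end_near. Qed.

End MonotoneDensity.

(** * Poissonization *)

(** [Phi_r] of the overview. *)
Definition poisson_sum (R : realType) (q : nat -> R) (r : nat) (t : R) : R :=
  sumR (fun j => poisson_tail r (t * q j)).
Arguments poisson_sum {R}.

(** [a_r n] of the overview; [integral_K_ge] identifies it with the expectation. *)
Definition binom_sum (R : realType) (q : nat -> R) (r n : nat) : R :=
  sumR (fun j => binom_tail n r (q j)).
Arguments binom_sum {R}.

Section Depoissonization.
Context {R : realType} (q : nat -> R).
Hypothesis sq : nnsummable q.
Hypothesis q1 : sumR q = 1.

Lemma q_bounds j : 0 <= q j <= 1.
Proof.
rewrite sq.1 -q1 -lee_fin sumRE//.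
have q0 i : (0 <= (q i)%:E)%E by rewrite lee_fin sq.1.
apply: le_trans (nneseries_lim_ge j.+1 (fun i _ _ => q0 i)).
by rewrite big_nat_recr//= leeDr// sume_ge0.
Qed.

Lemma nnsummable_poisson r t : 0 <= t ->
  nnsummable (fun j => poisson_tail r.+1 (t * q j)).
Proof.
move=> t0; apply: (nnsummable_le _ (fun j => t * q j)); last exact: nnsummableZ.
have tq j : 0 <= t * q j by rewrite mulr_ge0// sq.1.
by move=> j; rewrite poisson_tail_ge0 ?poisson_tail_le.
Qed.

Lemma nnsummable_binom r n : nnsummable (fun j => binom_tail n r.+1 (q j)).
Proof.
apply: (nnsummable_le _ (fun j => n%:R * q j)); last exact: nnsummableZ.
by move=> j; rewrite binom_tail_ge0 ?binom_tail_le_mulrn ?q_bounds.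
Qed.

(** Termwise [poisson_tail_scale]. It encodes t Phi_r' = r (Phi_r - Phi_{r+1}) as a tangent
    inequality in the variable l^r, so no series has to be differentiated. *)
Lemma poisson_sum_scale r l t : 0 < l -> 0 <= t ->
  poisson_sum q r.+1 (l * t) <= poisson_sum q r.+1 t +
    (poisson_sum q r.+1 t - poisson_sum q r.+2 t) * (l ^+ r.+1 - 1).
Proof.
move=> l0 t0; set L := l ^+ r.+1.
have L0 : 0 <= L by rewrite exprn_ge0// ltW.
have s1 := nnsummable_poisson r t t0.
have s2 := nnsummable_poisson r.+1 t t0.
have s3 := nnsummable_poisson r (l * t) (mulr_ge0 (ltW l0) t0).
have s4 := nnsummableZ L _ L0 s1.
have s5 := nnsummableZ L _ L0 s2.
(* The negative terms change sides, so that both sides are sums of nonnegative series. *)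
suff : poisson_sum q r.+1 (l * t) + L * poisson_sum q r.+2 t <=
       L * poisson_sum q r.+1 t + poisson_sum q r.+2 t by lra.
rewrite /poisson_sum -!sumRZ// -!sumRD//; apply: sumR_le; [exact: nnsummableD..|].
move=> j; have := poisson_tail_scale r (t * q j) l.
by rewrite mulr_ge0 ?sq.1// -mulrA -/L => /(_ isT l0); lra.
Qed.

Lemma binom_sum_incr r n :
  binom_sum q r.+1 n <= binom_sum q r.+1 n.+1 <= binom_sum q r.+1 n + 1.
Proof.
have s1 := nnsummable_binom r n; have s2 := nnsummable_binom r n.+1.
apply/andP; split.
  by apply: sumR_le => // j; case/andP: (binom_tail_incr n r.+1 _ (q_bounds j)).
rewrite -[X in _ + X]q1 -sumRD//; apply: sumR_le => //; first exact: nnsummableD.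
by move=> j; case/andP: (binom_tail_incr n r.+1 _ (q_bounds j)).
Qed.

(** If n p <= M, Le Cam's error n p^2 is at most M p. If n p > M, monotonicity in p compares both
    tails with their values at n p = M, so both are at least 1 - 2e and the factor 1 - 2e absorbs
    the difference. The error M p is summable over p = q j, with sum M. *)
Lemma binom_poisson_sandwich r n (M e p : R) : 0 < M -> (0 < n)%N ->
  1 - e <= poisson_tail r M -> M ^+ 2 <= e * n%:R -> 0 <= p <= 1 ->
  0 < e <= 1/2 ->
  (1 - 2 * e) * poisson_tail r (n%:R * p) <= binom_tail n r p + M * p /\
  (1 - 2 * e) * binom_tail n r p <= poisson_tail r (n%:R * p) + M * p.
Proof.
move=> M0 n0 hM Mn p01 e12.
have nR : 0 < n%:R :> R by rewrite ltr0n.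
have np0 : 0 <= n%:R * p by rewrite mulr_ge0 ?(ltW nR)//; lra.
have h0 := poisson_tail_ge0 r _ np0; have h1 := poisson_tail_le1 r _ np0.
have b0 := binom_tail_ge0 n r _ p01; have b1 := binom_tail_le1 n r _ p01.
have Mp : 0 <= M * p by rewrite mulr_ge0 ?(ltW M0)//; lra.
have [npM|npM] := leP (n%:R * p) M.
  have := binom_poisson_tail n r p p01.
  have : n%:R * p ^+ 2 <= M * p.
    by rewrite expr2 mulrA ler_wpM2r//; lra.
  have eh : 0 <= e * poisson_tail r (n%:R * p) by rewrite mulr_ge0//; lra.
  have eb : 0 <= e * binom_tail n r p by rewrite mulr_ge0//; lra.
  rewrite ler_norml => h2 /andP[h3 h4].
  split; lra.
have MnR : M / n%:R <= p by rewrite ler_pdivrMr// mulrC ltW.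
have Mn0 : 0 <= M / n%:R by rewrite divr_ge0// ltW.
have hB := binom_tail_homo n r _ _ Mn0 MnR ltac:(lra).
have hP := poisson_tail_homo r _ _ (ltW M0) (ltW npM).
have Mn1 : 0 <= M / n%:R <= 1 by lra.
have := binom_poisson_tail n r _ Mn1.
have -> : n%:R * (M / n%:R) = M by rewrite mulrC divfK// gt_eqF.
have : n%:R * (M / n%:R) ^+ 2 <= e.
  have -> : n%:R * (M / n%:R) ^+ 2 = M ^+ 2 / n%:R by field; rewrite gt_eqF.
  by rewrite ler_pdivrMr.
rewrite ler_norml => h2 /andP[h3 h4]; split; nra.
Qed.

Hypothesis q_infinite : forall M, exists2 x, 0 < x & M <= tail_count q x.

(** Each j with q j >= x contributes at least 1/2 once n x is large, and the number of such j is as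
    large as desired. *)
Lemma poisson_sum_unbounded r (M : R) :
  \forall n \near \oo, M <= poisson_sum q r.+1 n%:R.
Proof.
have [s s0 hs] := @poisson_tail_near1 R r.+1 (1 / 2) ltac:(lra).
have [x x0 hx] := q_infinite (2 * `|M|).
near=> n.
have nx : s <= n%:R * x.
  rewrite -ler_pdivrMr//; near: n; exact: nbhs_infty_ger.
apply: (@le_trans _ _ (1 / 2 * tail_count q x)).
  by have := ler_norm M; lra.
rewrite -sumRZ; [|by lra|exact: nnsummable_tail].
apply: sumR_le; [|exact: nnsummable_poisson|].
  by apply: nnsummableZ; [lra|exact: nnsummable_tail].
move=> j; have nq : 0 <= n%:R * q j by rewrite mulr_ge0// sq.1.
case: (leP x (q j)) => hj; last by rewrite mulr0n mulr0 poisson_tail_ge0.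
rewrite mulr1n.
have : s <= n%:R * q j by apply: le_trans nx _; rewrite ler_wpM2l.
by move=> /(poisson_tail_homo r.+1 _ _ (ltW s0)); lra.
Unshelve. all: by end_near. Qed.

(** Summing the sandwich over j leaves an additive error [M], negligible against the divergent
    Poisson sum. *)
Lemma binom_poisson_sum_cvg r :
  binom_sum q r.+1 n / poisson_sum q r.+1 n%:R @[n --> \oo] --> (1 : R).
Proof.
apply/cvgrPdist_le => eps eps0.
pose e : R := Num.min (1 / 8) (eps / 8).
have e0 : 0 < e by rewrite lt_min !divr_gt0.
have e1 : e <= 1 / 8 by rewrite ge_min lexx.
have e2 : 8 * e <= eps by rewrite mulrC -ler_pdivlMr// ge_min lexx orbT.
have [M M0 hM] := poisson_tail_near1 r.+1 e e0.
near=> n.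
have n0 : (0 < n)%N by near: n; exact: nbhs_infty_gt.
have Mn : M ^+ 2 <= e * n%:R.
  by rewrite mulrC -ler_pdivrMr//; near: n; exact: nbhs_infty_ger.
have PM : M / e + 1 <= poisson_sum q r.+1 n%:R by near: n; exact: poisson_sum_unbounded.
have sw j := binom_poisson_sandwich r.+1 n M e (q j) M0 n0 hM Mn (q_bounds j) ltac:(lra).
have s1 := nnsummable_poisson r n%:R (ler0n _ _).
have s2 := nnsummable_binom r n.
have s3 := nnsummableZ M _ (ltW M0) sq.
have s4 := nnsummableD _ _ s1 s3; have s5 := nnsummableD _ _ s2 s3.
have e3 : 0 <= 1 - 2 * e by lra.
have S1 : (1 - 2 * e) * poisson_sum q r.+1 n%:R <= binom_sum q r.+1 n + M.
  have -> : M = M * sumR q by rewrite q1 mulr1.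
  rewrite /poisson_sum /binom_sum -!sumRZ ?(ltW M0)// -sumRD//.
  by apply: sumR_le => //; [exact: nnsummableZ|move=> j; case: (sw j)].
have S2 : (1 - 2 * e) * binom_sum q r.+1 n <= poisson_sum q r.+1 n%:R + M.
  have -> : M = M * sumR q by rewrite q1 mulr1.
  rewrite /poisson_sum /binom_sum -!sumRZ ?(ltW M0)// -sumRD//.
  by apply: sumR_le => //; [exact: nnsummableZ|move=> j; case: (sw j)].
move: (poisson_sum q _ _) (binom_sum q _ _) PM S1 S2 => P B PM S1 S2.
have Me : 0 < M / e by rewrite divr_gt0.
have MP : M <= e * P by rewrite mulrC -ler_pdivrMr//; lra.
have P0 : 0 < P by lra.
have B1 : (1 - 3 * e) * P <= B by lra.
have B2 : B <= (1 + 8 * e) * P.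
  rewrite -(@ler_pM2l _ (1 - 2 * e)); last lra.
  rewrite (le_trans S2)// mulrA -[X in X + _ <= _]mul1r.
  (* Then 1 + e <= (1 - 2e) (1 + 8e), because e <= 1/8. *)
  apply: (@le_trans _ _ ((1 + e) * P)); first lra.
  by rewrite ler_pM2r//; nra.
rewrite -(@ler_pM2r _ P)// -[X in _ * X <= _](gtr0_norm P0) -normrM mulrBl mul1r.
rewrite divfK ?gt_eqF//.
have : 8 * e * P <= eps * P by rewrite ler_pM2r.
have : 0 < e * P by rewrite mulr_gt0.
rewrite ler_norml; lra.
Unshelve. all: by end_near. Qed.

Variable alpha : R.
Hypothesis alpha0 : 0 < alpha.
Hypothesis q_scale : forall l c, 0 < l -> 0 <= c -> c < l `^ alpha ->
  exists2 delta, 0 < delta & forall x, 0 < x -> x <= delta ->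
    c * tail_count q x <= tail_count q (x / l).

(** With l = exp(u), the layer-cake comparison bounds Phi (l n) below by about l^alpha Phi (n), and
    [poisson_sum_scale] bounds it above; together they give the hypothesis of [monotone_density]. *)
Lemma poisson_sum_ratio_cvg r :
  poisson_sum q r.+2 n%:R / poisson_sum q r.+1 n%:R @[n --> \oo] -->
    1 - alpha / r.+1%:R.
Proof.
pose x n := (poisson_sum q r.+1 n%:R - poisson_sum q r.+2 n%:R) /
            poisson_sum q r.+1 n%:R.
have rR : r.+1%:R != 0 :> R by rewrite pnatr_eq0.
suff H : r.+1%:R * x n @[n --> \oo] --> alpha.
  have {}H : 1 - (r.+1%:R * x n) / r.+1%:R @[n --> \oo] --> 1 - alpha / r.+1%:R.
    by apply: cvgB; [exact: cvg_cst|apply: cvgM => //; exact: cvg_cst].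
  apply: cvg_trans H; apply: near_eq_cvg; near=> n.
  have P0 : 1 <= poisson_sum q r.+1 n%:R by near: n; exact: poisson_sum_unbounded.
  have {}P0 : poisson_sum q r.+1 n%:R != 0 by rewrite gt_eqF//; lra.
  rewrite /x; move: (poisson_sum _ _ _) (poisson_sum _ _ _) P0 => P1 P2 P0.
  by rewrite mulrAC divff// mul1r; field.
apply: monotone_density => // u eta eta0.
(* Just below l^alpha = exp(alpha u), truncated at 0 because the comparison asks for c >= 0. The
   other eta / 2 absorbs the constant c * tail_count q d, thanks to [Pn]. *)
pose c := Num.max 0 (expR (alpha * u) - eta / 2).
have l0 := expR_gt0 u.
have lE : expR u `^ alpha = expR (alpha * u) by rewrite /powR gt_eqF// expRK.
have c0 : 0 <= c by rewrite le_max lexx.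
have cl : c < expR u `^ alpha by rewrite lE gt_max expR_gt0; lra.
have [d d0 hd] := q_scale _ _ l0 c0 cl.
near=> n.
have Pn : c * tail_count q d / (eta / 2) + 1 <= poisson_sum q r.+1 n%:R.
  by near: n; exact: poisson_sum_unbounded.
have n0 : 0 < n%:R :> R by rewrite ltr0n; near: n; exact: nbhs_infty_gt.
have nn u' : 0 <= u' -> 0 <= n%:R * u' by move=> ?; rewrite mulr_ge0// ltW.
have := @layer_cake_le R q sq (fun s => poisson_tail r.+1 (n%:R * s)) n%:R.
move=> /(_ _ _ n0 _ _ _ _ l0 c0 d0 hd) lc.
have {}lc : c * poisson_sum q r.+1 n%:R <=
   poisson_sum q r.+1 (expR u * n%:R) + c * tail_count q d.
  have -> : poisson_sum q r.+1 (expR u * n%:R) =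
     sumR (fun j => poisson_tail r.+1 (n%:R * (expR u * q j))).
    by rewrite /poisson_sum; congr sumR; apply/funext => j; rewrite mulrCA mulrA.
  apply: lc.
  - by move=> s v s0 sv; rewrite poisson_tail_homo ?nn// ler_pM2l.
  - by move=> s s0; rewrite poisson_tail_ge0 ?poisson_tail_le1 ?nn.
  - by move=> s s0; rewrite poisson_tail_le ?nn.
have := poisson_sum_scale r _ _ l0 (ltW n0).
rewrite /x; move: lc Pn.
set K := c * tail_count q d.
have K0 : 0 <= K by rewrite mulr_ge0// sumR_ge0//; exact: nnsummable_tail.
move: (poisson_sum q r.+1 n%:R) (poisson_sum q r.+1 (expR u * n%:R))
  (poisson_sum q r.+2 n%:R).
move=> P Pl P2 lc Pn hs.
have e2 : 0 < eta / 2 by rewrite divr_gt0.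
have Ke : 0 <= K / (eta / 2) by rewrite divr_ge0// ltW.
have P0 : 0 < P by lra.
have KP : K <= eta / 2 * P by rewrite mulrC -ler_pdivrMr//; lra.
have ce : expR (alpha * u) - eta / 2 <= c by rewrite le_max lexx orbT.
have Pn0 : P != 0 by rewrite gt_eqF.
rewrite -(ler_pM2r P0).
rewrite [leRHS](_ : _ = P + (P - P2) * (expR u ^+ r.+1 - 1)); last by field.
have : (expR (alpha * u) - eta / 2) * P <= c * P by rewrite ler_pM2r.
lra.
Unshelve. all: by end_near. Qed.

Lemma binom_sum_ratio_cvg r :
  binom_sum q r.+2 n / binom_sum q r.+1 n @[n --> \oo] --> 1 - alpha / r.+1%:R.
Proof.
have H : (binom_sum q r.+2 n / poisson_sum q r.+2 n%:R) *
   (poisson_sum q r.+2 n%:R / poisson_sum q r.+1 n%:R) /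
   (binom_sum q r.+1 n / poisson_sum q r.+1 n%:R) @[n --> \oo] -->
   1 * (1 - alpha / r.+1%:R) / 1.
  apply: cvgM.
    by apply: cvgM; [exact: binom_poisson_sum_cvg|exact: poisson_sum_ratio_cvg].
  by apply: cvgV; [rewrite oner_eq0|exact: binom_poisson_sum_cvg].
rewrite mul1r divr1 in H.
apply: cvg_trans H; apply: near_eq_cvg; near=> n.
have P1 : 1 <= poisson_sum q r.+1 n%:R by near: n; exact: poisson_sum_unbounded.
have P2 : 1 <= poisson_sum q r.+2 n%:R by near: n; exact: poisson_sum_unbounded.
have {}P1 : poisson_sum q r.+1 n%:R != 0 by rewrite gt_eqF//; lra.
have {}P2 : poisson_sum q r.+2 n%:R != 0 by rewrite gt_eqF//; lra.
have B : 0 < binom_sum q r.+1 n / poisson_sum q r.+1 n%:R.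
  by near: n; apply: (cvgr_gt _ (binom_poisson_sum_cvg r)); exact: ltr01.
have {}B : binom_sum q r.+1 n != 0 by apply: contraTneq B => ->; rewrite mul0r ltxx.
by field; rewrite P1 P2 B.
Unshelve. all: by end_near. Qed.

Lemma binom_sum_unbounded r (M : R) : exists n, M <= binom_sum q r.+1 n.
Proof.
suff /filter_ex[n hn] : \forall n \near \oo, M <= binom_sum q r.+1 n by exists n.
near=> n.
have P1 : 2 * `|M| + 1 <= poisson_sum q r.+1 n%:R.
  by near: n; exact: poisson_sum_unbounded.
have : 1 / 2 < binom_sum q r.+1 n / poisson_sum q r.+1 n%:R.
  by near: n; apply: (cvgr_gt _ (binom_poisson_sum_cvg r)); lra.
have := normr_ge0 M; have := ler_norm M => h1 h2.
by rewrite ltr_pdivlMr; lra.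
Unshelve. all: by end_near. Qed.

End Depoissonization.

(** * From a subsequence to the whole sequence *)

Section Subsequence.
Context {R : realType} (a : nat -> R).
Hypothesis a_incr : forall n, a n <= a n.+1 <= a n + 1.
Hypothesis a0 : a 0%N = 0.
Hypothesis a_unbounded : forall M, exists n, M <= a n.

Lemma a_homo m n : (m <= n)%N -> a m <= a n.
Proof.
move=> /subnK <-; elim: (n - m)%N => // k IH.
by apply: (le_trans IH); case/andP: (a_incr (k + m)).
Qed.

(** The first time at which [a] reaches (k + 1)^2; starting from level 1 keeps [a] positive along
    these times. *)
Definition square_time (k : nat) : nat := ex_minn (a_unbounded (k.+1%:R ^+ 2)).

(** By minimality the previous value is below the level, and a step is at most 1. *)
Lemma square_timeP k : k.+1%:R ^+ 2 <= a (square_time k) <= k.+1%:R ^+ 2 + 1.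
Proof.
rewrite /square_time; case: ex_minnP => -[|m] hm min; rewrite hm /=.
  by rewrite a0 addr_ge0// exprn_ge0.
have /andP[_ ] := a_incr m.
have : a m < k.+1%:R ^+ 2.
  by rewrite ltNge; apply/negP => /min; rewrite ltnn.
lra.
Qed.

Lemma square_time_min k n : k.+1%:R ^+ 2 <= a n -> (square_time k <= n)%N.
Proof. by rewrite /square_time; case: ex_minnP => m _; apply. Qed.

(** Both sequences are monotone, so K n / a n is squeezed between the values at consecutive square
    times, and the ratio of consecutive squares tends to 1. *)
Lemma subsequence_ratio_cvg (K : nat -> R) :
  (forall n, K n <= K n.+1) ->
  K (square_time k) / a (square_time k) @[k --> \oo] --> (1 : R) ->
  K n / a n @[n --> \oo] --> (1 : R).
Proof.
move=> K_incr Kh.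
have K_homo m n : (m <= n)%N -> K m <= K n.
  by move=> /subnK <-; elim: (n - m)%N => // k IH; exact: le_trans (K_incr _).
apply/cvgrPdist_le => eps eps0.
pose e : R := Num.min (1 / 3) (eps / 3).
have e0 : 0 < e by rewrite lt_min !divr_gt0.
have e1 : e <= 1 / 3 by rewrite ge_min lexx.
have e2 : 3 * e <= eps by rewrite mulrC -ler_pdivlMr// ge_min lexx orbT.
have /cvgrPdist_le/(_ _ e0)[k0 _ hk0] := Kh.
(* The three bounds make the predecessor of k usable, give closeness at the square times from [k0]
   on, and make consecutive squares close (k + 1 >= 4 / e). *)
pose k1 := maxn 1 (maxn k0 (Num.bound `|4 / e|)).
exists (square_time k1) => // n /= hn.
have an1 : k1.+1%:R ^+ 2 <= a n.
  by apply: le_trans (a_homo _ _ hn); case/andP: (square_timeP k1).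
have exk : exists k, a n < k.+2%:R ^+ 2.
  exists (Num.bound `|a n|).
  have := archi_boundP (normr_ge0 (a n)); have := ler_norm (a n).
  move: (Num.bound _) => b; rewrite -[b.+2]addn2 natrD; have := ler0n R b; nra.
(* The minimal such k satisfies (k + 1)^2 <= a n < (k + 2)^2. *)
case: (ex_minnP exk) => k hk kmin.
have k1k : (k1 <= k)%N.
  have : k1.+1%:R ^+ 2 < k.+2%:R ^+ 2 :> R by exact: le_lt_trans hk.
  by rewrite ltr_pXn2r ?nnegrE// ltr_nat ltnS.
have [hK0 hK1] : k.+1%:R ^+ 2 <= a n /\ (0 < k)%N.
  have k_gt0 : (0 < k)%N by apply: leq_trans k1k; rewrite leq_max.
  split => //; rewrite leNgt; apply/negP; rewrite -{1}(prednK k_gt0) => /kmin.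
  by rewrite leqNgt prednK// leqnn.
have hkn : (square_time k <= n)%N by exact: square_time_min.
have nhk : (n <= square_time k.+1)%N.
  rewrite leqNgt; apply/negP => /ltnW /a_homo; have /andP[+ _] := square_timeP k.+1.
  lra.
have k0k : (k0 <= k)%N by apply: leq_trans k1k; rewrite !leq_max leqnn orbT.
have := hk0 _ k0k; have := hk0 k.+1 (leqW k0k).
rewrite /=; have := square_timeP k; have := square_timeP k.+1.
have := K_homo _ _ hkn; have := K_homo _ _ nhk.
have bk : 4 / e <= k.+1%:R.
  apply: ltW; apply: (le_lt_trans (ler_norm _)).
  apply: (lt_le_trans (archi_boundP (normr_ge0 _))).
  rewrite ler_nat; apply: leqW; apply: leq_trans k1k.
  by rewrite !leq_max leqnn !orbT.
move: hk hK0 bk; rewrite -[k.+2%:R]natr1.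
have : 1 <= k.+1%:R :> R by rewrite ler1n.
move: (a n) (K n) (a (square_time k)) (a (square_time k.+1))
  (K (square_time k)) (K (square_time k.+1)) (k.+1%:R).
move=> A B A1 A2 K1 K2 s s1 As sA es B2 B1 hA2 hA1.
have A10 : 0 < A1 by nra.
have A20 : 0 < A2 by nra.
have A0 : 0 < A by nra.
have es4 : 4 <= e * s by rewrite mulrC -ler_pdivrMr.
(* With s = k + 1 >= 1: 2s + 2 <= 4s <= e s^2. *)
have S2 : (s + 1) ^+ 2 + 1 <= (1 + e) * s ^+ 2.
  have : 4 * s <= e * s * s by rewrite ler_pM2r//; lra.
  rewrite !expr2; nra.
rewrite !ler_norml => /andP[h1 h2] /andP[h3 h4].
have h5 : K2 <= (1 + e) * A2 by rewrite -ler_pdivrMr//; lra.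
have h6 : (1 - e) * A1 <= K1 by rewrite -ler_pdivlMr//; lra.
have h7 : B <= (1 + e) * ((1 + e) * A).
  apply: (le_trans B2); apply: (le_trans h5); rewrite ler_pM2l; last lra.
  have : (1 + e) * s ^+ 2 <= (1 + e) * A by rewrite ler_pM2l//; lra.
  lra.
have h8 : (1 - e) * ((1 - e) * A) <= B.
  apply: le_trans B1; apply: le_trans h6; rewrite ler_pM2l; last lra.
  have : (1 - e) * A <= (1 - e) * ((1 + e) * s ^+ 2) by rewrite ler_pM2l; lra.
  have : 0 <= e * e * s ^+ 2 by rewrite mulr_ge0 ?mulr_ge0 ?exprn_ge0//; lra.
  lra.
have h9 : B / A <= (1 + e) * (1 + e) by rewrite ler_pdivrMr// -mulrA.
have h10 : (1 - e) * (1 - e) <= B / A by rewrite ler_pdivlMr// -mulrA.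
apply/andP; split; nra.
Qed.

End Subsequence.

(** * Almost sure convergence from summable expectations *)

Section AlmostEverywhere.
Local Open Scope ereal_scope.
Context {d : measure_display} {T : measurableType d} {R : realType}.
Variable mu : {measure set T -> \bar R}.

(** By Tonelli the series of the f k is integrable, hence finite almost everywhere, and its terms
    tend to 0 there. This does the work of Chebyshev's inequality and the Borel-Cantelli lemma
    together. *)
Lemma ae_cvg0_of_summable_integral (f : nat -> T -> R) :
  (forall k, measurable_fun setT (f k)) -> (forall k w, (0 <= f k w)%R) ->
  \sum_(k <oo) \int[mu]_w (f k w)%:E < +oo ->
  {ae mu, forall w, f k w @[k --> \oo] --> (0 : R)%R}.
Proof.
move=> mf f0 fin.
have mfE k : measurable_fun setT (fun w => (f k w)%:E) by exact/measurable_EFinP.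
have intF : mu.-integrable setT (fun w => \sum_(k <oo) (f k w)%:E).
  apply/integrableP; split.
    by apply: ge0_emeasurable_sum => // k w _ _; rewrite lee_fin.
  rewrite (eq_integral (fun w => \sum_(k <oo) (f k w)%:E)); last first.
    by move=> w _; rewrite gee0_abs// nneseries_ge0// => *; rewrite lee_fin.
  by rewrite integral_nneseries// => *; rewrite lee_fin.
apply: filterS (integrable_ae measurableT intF) => w /(_ I).
rewrite ge0_fin_numE; last by apply: nneseries_ge0 => *; rewrite lee_fin.
by move=> h; apply: nnsummable_cvg0; split.
Qed.

Lemma sum_inv_square_lty : \sum_(k <oo) ((k.+1%:R ^- 2)%R : R)%:E < +oo.
Proof.
apply: (@le_lt_trans _ _ 2%:E); last exact: ltry.
apply: lime_le; first by apply: is_cvg_nneseries => *; rewrite lee_fin.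
apply: nearW => n; rewrite sumEFin lee_fin big_mkord.
case: n => [|n]; first by rewrite big_ord0.
(* Telescoping: 1 / (x + 1)^2 <= 1 / x - 1 / (x + 1). *)
suff : (\sum_(k < n.+1) k.+1%:R ^- 2 <= 2 - n.+1%:R^-1 :> R)%R.
  by move/le_trans; apply; rewrite gerBl invr_ge0.
elim: n => [|n IH]; first by rewrite big_ord1 expr1n invr1; lra.
rewrite big_ord_recr/= -[n.+2%:R]natr1.
have : (0 < n.+1%:R :> R)%R by rewrite ltr0n.
move: IH; move: (n.+1%:R : R)%R => x IH x0.
suff : ((x + 1) ^- 2 <= x^-1 - (x + 1)^-1)%R by lra.
have -> : (x^-1 - (x + 1)^-1 = (x * (x + 1))^-1)%R.
  by field; rewrite !gt_eqF//; lra.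
by rewrite lef_pV2 ?posrE ?exprn_gt0 ?mulr_gt0//; [nra|lra..].
Qed.

End AlmostEverywhere.

(** * Occupancy counts *)

Section Occupancy.
Context {T : Type} (U : nat -> T -> nat).

Lemma occupancyS n j w :
  occupancy U n.+1 j w = (occupancy U n j w + (U n w == j))%N.
Proof. by rewrite /occupancy big_ord_recr. Qed.

Lemma occupancy0 j w : occupancy U 0 j w = 0%N.
Proof. by rewrite /occupancy big_ord0. Qed.

Lemma occupancy_support n w :
  exists N, forall j, (N <= j)%N -> occupancy U n j w = 0%N.
Proof.
elim: n => [|n [N hN]]; first by exists 0%N => j _; exact: occupancy0.
exists (maxn N (U n w).+1) => j; rewrite geq_max => /andP[Nj Uj].
by rewrite occupancyS hN// ltn_eqF.
Qed.

End Occupancy.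

(** * Laws and negative correlation of occupancy counts *)

Section IndependentFuture.
Local Open Scope ereal_scope.
Context {R : realType} {d : measure_display} {T : measurableType d}.
Variables (P : probability T R) (U : nat -> {RV P >-> nat}).
Hypothesis indU : mutually_independent P (fun i => U i : T -> nat).

(* [E] has probability [x] and is independent of [U n, U n.+1, ...]. *)
Definition indep_future (n : nat) (E : set T) (x : R) : Prop :=
  measurable E /\
  forall (J : {fset nat}) (A : nat -> set nat),
    (forall i, i \in J -> (n <= i)%N) ->
    P (E `&` \bigcap_(i in [set` J]) (U i @^-1` A i)) =
    x%:E * \prod_(i <- J) P (U i @^-1` A i).

Lemma measurable_preimage_nat i (B : set nat) : measurable (U i @^-1` B).
Proof. by rewrite -[_ @^-1` _]setTI; exact: (measurable_funP (U i)). Qed.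

Lemma indep_future_prob n E x : indep_future n E x -> P E = x%:E.
Proof.
move=> [mE /(_ fset0 (fun=> setT))].
rewrite big_seq_fset0 mule1 (_ : \bigcap_(i in _) _ = setT) ?setIT; first exact.
by apply/seteqP; split => // w _ i /=; rewrite inE.
Qed.

Lemma indep_future_ge0 n E x : indep_future n E x -> (0 <= x)%R.
Proof. by move=> /indep_future_prob PE; rewrite -lee_fin -PE. Qed.

Lemma indep_futureT n : indep_future n setT 1%R.
Proof.
by split => // J A _; rewrite setTI mul1e indU.
Qed.

Lemma indep_futureU n E F x y : E `&` F = set0 ->
  indep_future n E x -> indep_future n F y ->
  indep_future n (E `|` F) (x + y)%R.
Proof.
move=> EF hE hF.
have x0 := indep_future_ge0 _ _ _ hE; have y0 := indep_future_ge0 _ _ _ hF.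
case: hE hF => mE hE [mF hF]; split; first exact: measurableU.
move=> J A hJ; have mJ : measurable (\bigcap_(i in [set` J]) (U i @^-1` A i)).
  by apply: bigcap_measurableType => i _; exact: measurable_preimage_nat.
transitivity (P (E `&` \bigcap_(i in [set` J]) (U i @^-1` A i)) +
    P (F `&` \bigcap_(i in [set` J]) (U i @^-1` A i))).
  rewrite setIUl; apply: measureU; [exact: measurableI..|].
  by rewrite setIACA EF set0I.
by rewrite hE// hF// EFinD ge0_muleDl ?lee_fin.
Qed.

(** The constraint on [U n] joins the constraints on the future: apply the independence of [E] to
    the index set enlarged by n, with [B] prescribed at n. *)
Lemma indep_future_step n E x (B : set nat) y : indep_future n E x ->
  P (U n @^-1` B) = y%:E ->
  indep_future n.+1 (E `&` U n @^-1` B) (x * y)%R.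
Proof.
move=> [mE hE] PB; split.
  by apply: measurableI => //; exact: measurable_preimage_nat.
move=> J A hJ; pose A' i := if i == n then B else A i.
have nJ : n \notin J by apply/negP => /hJ; rewrite ltnn.
have /= := hE (n |` J)%fset A'.
rewrite big_fsetU1//= /A' eqxx PB muleA -EFinM => h.
rewrite -setIA; transitivity
  (P (E `&` \bigcap_(i in [set` (n |` J)%fset]) (U i @^-1` A' i))).
  congr (P (_ `&` _)); apply/seteqP; split => w /=.
    move=> [Bw Jw] i /=; rewrite !inE /A' => /orP[/eqP->|iJ]; first by rewrite eqxx.
    by case: eqVneq => [->//|_]; exact: Jw.
  move=> Jw; split.
    by have := Jw n; rewrite /= /A' eqxx; apply; rewrite /= !inE eqxx.
  move=> i /= iJ; have := Jw i; rewrite /= /A' ifN.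
    by apply; rewrite /= !inE iJ orbT.
  by apply: contraNneq nJ => <-.
rewrite h; last by move=> i; rewrite !inE => /orP[/eqP->//|/hJ/ltnW].
congr (_ * _); rewrite big_seq [RHS]big_seq; apply: eq_bigr => i iJ.
by rewrite ifN//; apply: contraNneq nJ => <-.
Qed.

Arguments indep_future_step {n E x B y}.
Arguments indep_futureU {n E F x y}.

Variable p : nat -> R.
Hypothesis Up : forall i j : nat, (0 < j)%N -> P (U i @^-1` [set j]) = (p j)%:E.

Local Notation X := (occupancy (fun i => U i : T -> nat)).

Lemma prob_preimage_setC n (B : set nat) y : P (U n @^-1` B) = y%:E ->
  P (U n @^-1` (~` B)) = (1 - y)%:E.
Proof.
move=> PB; rewrite preimage_setC probability_setC ?PB//.
exact: measurable_preimage_nat.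
Qed.

Arguments prob_preimage_setC {n B y}.

(** Induction on n, splitting on whether U n = i; the two disjoint cases reproduce the recursion of
    [binom_tail]. *)
Lemma indep_future_occupancy n a i : (0 < i)%N ->
  indep_future n [set w | (a <= X n i w)%N] (binom_tail n a (p i)).
Proof.
move=> i0; elim: n a => [|n IH] [|a].
- rewrite (_ : [set w | _] = setT); first exact: indep_futureT.
  by apply/seteqP.
- rewrite (_ : [set w | _] = set0); last first.
    by apply/seteqP; split => w //=; rewrite occupancy0.
  by split => // J A _; rewrite set0I measure0 mul0e.
- rewrite (_ : [set w | _] = setT); first exact: indep_futureT.
  by apply/seteqP.
rewrite binom_tailS mulrC [in X in (_ + X)%R]mulrC.
have h1 := indep_future_step (IH a) (Up n i i0).
have h2 := indep_future_step (IH a.+1) (prob_preimage_setC (Up n i i0)).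
have := indep_futureU _ h1 h2; rewrite setIACA -preimage_setI setICr preimage_set0 setI0.
move=> /(_ erefl); congr indep_future; apply/seteqP; split => w /=; rewrite occupancyS.
  by move=> [[h ->]|[h /eqP/negbTE->]]; rewrite ?eqxx ?addn1 ?addn0.
case: eqVneq => [->|/eqP ?] /=; rewrite ?addn1 ?addn0; by [left|right].
Qed.

(** Induction on n, splitting on U n = i, U n = j or neither. The joint probability [x] is only
    bounded, but independence of the future must be carried along for the next step. *)
Lemma occupancy_negative_correlation n a b i j : (0 < i)%N -> (0 < j)%N -> i != j ->
  (0 <= p i <= 1)%R -> (0 <= p j <= 1)%R ->
  exists2 x, indep_future n [set w | (a <= X n i w)%N /\ (b <= X n j w)%N] x &
    (x <= binom_tail n a (p i) * binom_tail n b (p j))%R.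
Proof.
move=> i0 j0 ij pi pj.
have case0r n' b' : exists2 x,
    indep_future n' [set w | (0 <= X n' i w)%N /\ (b' <= X n' j w)%N] x &
    (x <= binom_tail n' 0 (p i) * binom_tail n' b' (p j))%R.
  exists (binom_tail n' b' (p j)); last by rewrite binom_tail0 mul1r.
  rewrite (_ : [set w | _] = [set w | (b' <= X n' j w)%N]).
    exact: indep_future_occupancy.
  by apply/seteqP; split => w //= [].
have case0l n' a' : exists2 x,
    indep_future n' [set w | (a' <= X n' i w)%N /\ (0 <= X n' j w)%N] x &
    (x <= binom_tail n' a' (p i) * binom_tail n' 0 (p j))%R.
  exists (binom_tail n' a' (p i)); last by rewrite binom_tail0 mulr1.
  rewrite (_ : [set w | _] = [set w | (a' <= X n' i w)%N]).
    exact: indep_future_occupancy.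
  by apply/seteqP; split => w //= [].
elim: n a b => [|n IH] [|a] [|b]; [exact: case0r|exact: case0r|exact: case0l| |
  exact: case0r|exact: case0r|exact: case0l|].
  exists 0%R; last by rewrite mulr0.
  rewrite (_ : [set w | _] = set0); last first.
    by apply/seteqP; split => w //=; rewrite occupancy0 => -[].
  by split => // J A _; rewrite set0I measure0 mul0e.
have Pij : P (U n @^-1` ([set i] `|` [set j])) = (p i + p j)%:E.
  transitivity (P (U n @^-1` [set i]) + P (U n @^-1` [set j])); last first.
    by rewrite !Up.
  rewrite preimage_setU; apply: measureU; [exact: measurable_preimage_nat..|].
  apply/seteqP; split => w //= [Ui Uj].
  by move: ij; rewrite -Ui Uj eqxx.
have [x1 h1 l1] := IH a b.+1; have [x2 h2 l2] := IH a.+1 b.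
have [x3 h3 l3] := IH a.+1 b.+1.
have g1 := indep_future_step h1 (Up n i i0).
have g2 := indep_future_step h2 (Up n j j0).
have g3 := indep_future_step h3 (prob_preimage_setC Pij).
have p3 : (0 <= 1 - (p i + p j))%R.
  rewrite -lee_fin -(prob_preimage_setC Pij); exact: measure_ge0.
exists (x1 * p i + (x2 * p j + x3 * (1 - (p i + p j))))%R.
  have g23 := indep_futureU _ g2 g3.
  have g123 := indep_futureU _ g1 (g23 _).
  have -> : [set w | (a < X n.+1 i w)%N /\ (b < X n.+1 j w)%N] =
    [set w | (a <= X n i w)%N /\ (b.+1 <= X n j w)%N] `&` U n @^-1` [set i] `|`
    ([set w | (a.+1 <= X n i w)%N /\ (b <= X n j w)%N] `&` U n @^-1` [set j] `|`
     [set w | (a.+1 <= X n i w)%N /\ (b.+1 <= X n j w)%N] `&`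
       U n @^-1` (~` ([set i] `|` [set j]))).
    apply/seteqP; split => w /=; rewrite !occupancyS.
      case: (eqVneq (U n w) i) => [Ui|Ui] /=.
        by rewrite Ui (negbTE ij) addn1 addn0 => h; left.
      case: (eqVneq (U n w) j) => [Uj|Uj] /=; rewrite ?addn1 !addn0 => h; right.
        by left.
      by right; split => // -[] /eqP; apply/negP.
    move=> [[h ->]|[[h ->]|[h /not_orP[/eqP/negbTE-> /eqP/negbTE->]]]].
    - by rewrite eqxx (negbTE ij) addn1 addn0.
    - by rewrite eqxx eq_sym (negbTE ij) addn1 addn0.
    - by rewrite !addn0.
  apply: g123.
    apply/seteqP; split => w //= -[[_ Ui] [[_ Uj]|[_ []]]]; last by left.
    by move: ij; rewrite -Ui Uj eqxx.
  by apply/seteqP; split => w //= -[[_ Uj] [_ []]]; right.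
rewrite !binom_tailS.
move: l1 l2 l3 (binom_tail_anti n a _ pi) (binom_tail_anti n b _ pj).
move: (binom_tail n a (p i)) (binom_tail n b (p j)) => g g'.
move: (binom_tail n a.+1 (p i)) (binom_tail n b.+1 (p j)) => f f' l1 l2 l3 gf gf'.
have := ler_wpM2r (proj1 (andP pi)) l1.
have := ler_wpM2r (proj1 (andP pj)) l2.
have := ler_wpM2r p3 l3.
(* This product is exactly the gap between the product of the expanded tails and the bound that the
   induction hypotheses give. *)
have : (0 <= p i * p j * ((g - f) * (g' - f')))%R.
  by rewrite !mulr_ge0 ?subr_ge0//; [case/andP: pi|case/andP: pj].
lra.
Qed.

End IndependentFuture.

(** * The counts as sums over j *)

Section Counts.
Context {R : realType} {T : Type} (U : nat -> T -> nat).

Lemma nnsummable_support (f : nat -> R) N : (forall j, 0 <= f j) ->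
  (forall j, (N <= j)%N -> f j = 0) -> nnsummable f.
Proof.
move=> f0 fN; split => //.
rewrite (nneseries_split 0 N); last by move=> *; rewrite lee_fin.
rewrite [X in (_ + X)%E]eseries0 ?adde0 ?sumEFin ?ltry//.
by move=> j; rewrite add0n => Nj _; rewrite fN.
Qed.

Lemma nnsummable_occupancy (f : nat -> R) n w : (forall k, 0 <= f k) ->
  f 0%N = 0 -> nnsummable (fun j => f (occupancy U n j.+1 w)).
Proof.
move=> f0 f00; have [N hN] := occupancy_support U n w.
by apply: (nnsummable_support _ N) => // j Nj; rewrite hN// leqW.
Qed.

Lemma K_geE n r w :
  K_ge R U n r w = sumR (fun j => (r <= occupancy U n j.+1 w)%N%:R).
Proof. by rewrite /K_ge nneseries_shift1// => *; rewrite lee_fin. Qed.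

Lemma nnsummable_K_ge n r w : (0 < r)%N ->
  nnsummable (fun j => (r <= occupancy U n j.+1 w)%N%:R : R).
Proof.
move=> r0; apply: (nnsummable_occupancy (fun k => (r <= k)%N%:R)) => //.
by rewrite leqNgt r0.
Qed.

Lemma K_eqE n r w : (0 < r)%N ->
  K_eq R U n r w = K_ge R U n r w - K_ge R U n r.+1 w.
Proof.
move=> r0; rewrite !K_geE; apply/eqP; rewrite eq_sym subr_eq; apply/eqP.
have s1 : nnsummable (fun j => (occupancy U n j.+1 w == r)%:R : R).
  apply: (nnsummable_occupancy (fun k => (k == r)%:R)) => //.
  by rewrite eq_sym gtn_eqF.
rewrite /K_eq nneseries_shift1; last by move=> *; rewrite lee_fin.
rewrite -[fine _]/(sumR _) -sumRD//; last exact: nnsummable_K_ge.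
congr sumR; apply/funext => j; rewrite leq_eqVlt eq_sym.
by case: eqVneq => [->|_] /=; rewrite ?ltnn ?addr0 ?add0r.
Qed.

Lemma K_ge_incr n r w : (0 < r)%N -> K_ge R U n r w <= K_ge R U n.+1 r w.
Proof.
move=> r0; rewrite !K_geE; apply: sumR_le; [exact: nnsummable_K_ge..|].
move=> j; apply: ler_bool => /leq_trans; apply.
by rewrite occupancyS leq_addr.
Qed.

End Counts.

(** * First and second moments *)

Section Moments.
Local Open Scope ereal_scope.
Context {R : realType} {d : measure_display} {T : measurableType d}.
Variables (P : probability T R) (p : nat -> R) (U : nat -> {RV P >-> nat}).
Hypothesis hU : iid_sample p U.
Let q j := p j.+1.
Hypothesis sq : nnsummable q.
Hypothesis q1 : sumR q = 1%R.

Local Notation X := (occupancy (fun i => U i : T -> nat)).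
Local Notation K := (K_ge R (fun i => U i : T -> nat)).

Let A n r j := [set w | (r <= X n j.+1 w)%N].

Let indA n r j : indep_future P U n (A n r j) (binom_tail n r (q j)).
Proof.
by case: hU => _ ind Up; exact: indep_future_occupancy.
Qed.

Let mA n r j : measurable (A n r j).
Proof. by case: (indA n r j). Qed.

Let PA n r j : P (A n r j) = (binom_tail n r (q j))%:E.
Proof. exact: indep_future_prob (indA n r j). Qed.

Let PAA n r j k : j != k ->
  P (A n r j `&` A n r k) <= (binom_tail n r (q j) * binom_tail n r (q k))%:E.
Proof.
move=> jk; case: hU => _ ind Up.
have qb := q_bounds q sq q1.
have [x hx xle] := occupancy_negative_correlation P U ind p Up n r r j.+1 k.+1 isT isT jk
  (qb j) (qb k).
by rewrite (indep_future_prob _ _ _ _ _ hx) lee_fin.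
Qed.

Let KE n r w : (0 < r)%N -> (K n r w)%:E = \sum_(j <oo) (\1_(A n r j) w)%:E.
Proof.
move=> r0; rewrite K_geE sumRE; last exact: nnsummable_K_ge.
apply: eq_eseriesr => j _; rewrite indicE; congr ((nat_of_bool _)%:R%:E).
by apply/idP/idP => [h|/set_mem//]; apply/mem_set.
Qed.

Let mI n r j : measurable_fun setT (fun w => (\1_(A n r j) w)%:E : \bar R).
Proof. by apply/measurable_EFinP; exact: measurable_indic. Qed.

Let intA n r j :
  \int[P]_w (\1_(A n r j) w)%:E = (binom_tail n r (q j))%:E.
Proof. by rewrite integral_indic// setIT; exact: PA. Qed.

Let intAA n r j k : j != k -> \int[P]_w (\1_(A n r j `&` A n r k) w)%:E <=
  (binom_tail n r (q j) * binom_tail n r (q k))%:E.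
Proof.
move=> jk; rewrite integral_indic//; last exact: measurableI.
by rewrite setIT; exact: PAA.
Qed.

Lemma measurable_K_ge n r : (0 < r)%N -> measurable_fun setT (K n r).
Proof.
move=> r0; apply/measurable_EFinP.
rewrite (_ : _ \o _ = fun w => \sum_(j <oo) (\1_(A n r j) w)%:E); last first.
  by apply/funext => w; rewrite /= KE.
by apply: ge0_emeasurable_sum => // j w _ _; rewrite lee_fin.
Qed.

Lemma K_ge_ge0 n r w : (0 < r)%N -> (0 <= K n r w)%R.
Proof. by move=> r0; rewrite K_geE sumR_ge0//; exact: nnsummable_K_ge. Qed.

Lemma integral_K_ge n r :
  \int[P]_w (K n r.+1 w)%:E = (binom_sum q r.+1 n)%:E.
Proof.
under eq_integral do rewrite KE//.
rewrite integral_nneseries//.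
rewrite /binom_sum sumRE; last exact: nnsummable_binom.
by apply: eq_eseriesr => j _; exact: intA.
Qed.

(** Expanding the square into a double series, the diagonal gives the expectation, and negative
    correlation bounds the rest by the square of the expectation. *)
Lemma integral_K_ge_sq n r : \int[P]_w (K n r.+1 w ^+ 2)%:E <=
  (binom_sum q r.+1 n + binom_sum q r.+1 n ^+ 2)%:E.
Proof.
set b := fun j => binom_tail n r.+1 (q j).
have sb : nnsummable b by exact: nnsummable_binom.
have b0 j : 0 <= (b j)%:E by rewrite lee_fin sb.1.
have I0 j w : 0 <= (\1_(A n r.+1 j) w : R)%:E by rewrite lee_fin.
have E w : (K n r.+1 w ^+ 2)%:E =
    \sum_(j <oo) \sum_(k <oo) (\1_(A n r.+1 j `&` A n r.+1 k) w)%:E.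
  rewrite expr2 EFinM {2}KE// -nneseriesZl//; apply: eq_eseriesr => j _.
  rewrite muleC KE// -nneseriesZl//; apply: eq_eseriesr => k _.
  by rewrite -EFinM indicI.
under eq_integral do rewrite E.
have mII j k : measurable_fun setT
    (fun w => (\1_(A n r.+1 j `&` A n r.+1 k) w)%:E : \bar R).
  by apply/measurable_EFinP; apply: measurable_indic; exact: measurableI.
rewrite integral_nneseries//; last 2 first.
  by move=> j; apply: ge0_emeasurable_sum => // *; rewrite lee_fin.
  by move=> j w _; apply: nneseries_ge0 => *; rewrite lee_fin.
(* The bound becomes a series in j, to be compared row by row: in row j the diagonal term is b j,
   and the other terms sum to at most b j times the total. *)
have -> : (binom_sum q r.+1 n + binom_sum q r.+1 n ^+ 2)%:E =
    \sum_(j <oo) ((1 + binom_sum q r.+1 n) * b j)%:E.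
  rewrite -sumRE; last by apply: nnsummableZ => //; rewrite addr_ge0// sumR_ge0.
  rewrite sumRZ//; last by rewrite addr_ge0// sumR_ge0.
  by rewrite -[sumR b]/(binom_sum q r.+1 n) mulrDl mul1r expr2.
apply: lee_nneseries => j _.
  by move=> _; apply: integral_ge0 => w _; apply: nneseries_ge0 => *; rewrite lee_fin.
rewrite integral_nneseries//.
rewrite (@nneseriesD1 R _ j)//; last first.
  by move=> *; apply: integral_ge0 => *; rewrite lee_fin.
rewrite setIid intA -/(b j) mulrDl mul1r EFinD; apply: leeD => //.
rewrite EFinM sumRE// muleC -nneseriesZl//.
apply: (@le_trans _ _ (\sum_(0 <= k <oo | true && (k != j)) (b j)%:E * (b k)%:E)).
  apply: lee_nneseries => k.
    by move=> *; apply: integral_ge0 => *; rewrite lee_fin.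
  by move=> /= kj; rewrite -EFinM; apply: intAA; rewrite eq_sym.
by apply: subset_lee_nneseries => // k _; rewrite mule_ge0.
by move=> i _; exact: b0.
Qed.

Lemma variance_K_ge n r :
  \int[P]_w ((K n r.+1 w - binom_sum q r.+1 n) ^+ 2)%:E <=
  (binom_sum q r.+1 n)%:E.
Proof.
set a := binom_sum q r.+1 n.
have a0 : (0 <= a)%R by rewrite sumR_ge0//; exact: nnsummable_binom.
have mK := @measurable_K_ge n r.+1 isT.
have mf : measurable_fun setT (fun w => ((K n r.+1 w - a) ^+ 2)%:E : \bar R).
  by apply/measurable_EFinP; apply: measurable_funX; exact: measurable_funB.
have mK2 : measurable_fun setT (fun w => (K n r.+1 w ^+ 2)%:E : \bar R).
  by apply/measurable_EFinP; exact: measurable_funX.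
(* (K - a)^2 + 2 a K = K^2 + a^2 keeps every integrand nonnegative; the finite term 2 a^2 is
   cancelled at the end. *)
have H : \int[P]_w (((K n r.+1 w - a) ^+ 2)%:E + (2 * a)%:E * (K n r.+1 w)%:E) =
         \int[P]_w ((K n r.+1 w ^+ 2)%:E + cst (a ^+ 2)%:E w).
  apply: eq_integral => w _; rewrite -EFinM -!EFinD /=; congr EFin; ring.
have a20 : (0 <= 2 * a)%R by rewrite mulr_ge0.
have K0 w : (0 <= (2 * a)%:E * (K n r.+1 w)%:E).
  by rewrite -EFinM lee_fin mulr_ge0// K_ge_ge0.
have mK3 : measurable_fun setT (fun w => (2 * a)%:E * (K n r.+1 w)%:E).
  by apply: measurable_funeM; exact/measurable_EFinP.
rewrite ge0_integralD// in H; last by move=> w _; rewrite lee_fin sqr_ge0.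
rewrite ge0_integralD// in H; last 2 first.
  by move=> w _; rewrite lee_fin sqr_ge0.
  by move=> w _; rewrite lee_fin sqr_ge0.
rewrite ge0_integralZl// in H; last 2 first.
  by apply/measurable_EFinP.
  by move=> w _; rewrite lee_fin K_ge_ge0.
have HC : \int[P]_w cst (a ^+ 2)%:E w = (a ^+ 2)%:E.
  by rewrite integral_cst// [X in _ * X](_ : _ = 1) ?mule1//; exact: probability_setT.
rewrite HC integral_K_ge -/a in H.
have h := integral_K_ge_sq n r; rewrite -/a in h.
have {}H : \int[P]_w ((K n r.+1 w - a) ^+ 2)%:E + (2 * a * a)%:E <=
   a%:E + (2 * a * a)%:E.
  rewrite EFinM H (_ : a%:E + _ = (a + a ^+ 2)%:E + (a ^+ 2)%:E).
    by apply: leeD.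
  by rewrite -!EFinD; congr EFin; ring.
by rewrite leeD2rE in H.
Qed.

End Moments.

(** * Strong law for the counts *)

Section StrongLaw.
Context {R : realType} {d : measure_display} {T : measurableType d}.
Variables (P : probability T R) (p : nat -> R) (U : nat -> {RV P >-> nat}).
Hypothesis hU : iid_sample p U.
Let q j := p j.+1.
Hypothesis sq : nnsummable q.
Hypothesis q1 : sumR q = 1%R.

Local Notation K := (K_ge R (fun i => U i : T -> nat)).

(** At the k-th square time the variance divided by a^2 is at most 1 / a <= 1 / (k + 1)^2, which is
    summable; monotonicity of the counts and of their means fills the gaps. *)
Lemma K_ge_strong_law r :
  (forall M, exists n, M <= binom_sum q r.+1 n) ->
  {ae P, forall w, K n r.+1 w / binom_sum q r.+1 n @[n --> \oo] --> (1 : R)}.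
Proof.
move=> unb; set a := binom_sum q r.+1 in unb *.
have a_incr n : a n <= a n.+1 <= a n + 1 by exact: binom_sum_incr.
have a0 : a 0%N = 0.
  by rewrite /a /binom_sum /sumR eseries0// => i _ _ /=.
pose h := square_time a unb.
have ah k : k.+1%:R ^+ 2 <= a (h k) by case/andP: (square_timeP a a_incr a0 unb k).
have k0 k : 0 < k.+1%:R ^+ 2 :> R by rewrite exprn_gt0.
have ah0 k : 0 < a (h k) by exact: lt_le_trans (ah k).
have an0 k : a (h k) != 0 by rewrite gt_eqF.
pose f k w := (K (h k) r.+1 w / a (h k) - 1) ^+ 2.
have fE k w : f k w = a (h k) ^- 2 * (K (h k) r.+1 w - a (h k)) ^+ 2.
  by rewrite /f; move: (an0 k); move: (a (h k)) => x x0; field.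
have mK n : measurable_fun setT (K n r.+1) by exact: (measurable_K_ge P p U hU).
have mf k : measurable_fun setT (f k).
  apply: measurable_funX; apply: measurable_funB => //.
  exact: measurable_funM.
have mg k : measurable_fun setT (fun w => (K (h k) r.+1 w - a (h k)) ^+ 2).
  by apply: measurable_funX; exact: measurable_funB.
have f0 k w : 0 <= f k w by exact: sqr_ge0.
have sumf : (\sum_(k <oo) \int[P]_w (f k w)%:E < +oo)%E.
  apply: le_lt_trans (sum_inv_square_lty (R := R)); apply: lee_nneseries => k.
    by move=> _ _; apply: integral_ge0 => w _; rewrite lee_fin.
  move=> _; under eq_integral do rewrite fE EFinM.
  have ak0 : 0 <= a (h k) ^- 2 by rewrite invr_ge0 sqr_ge0.
  rewrite ge0_integralZl//; last 2 first.
    exact/measurable_EFinP.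
    by move=> w _; rewrite lee_fin sqr_ge0.
  apply: (@le_trans _ _ ((a (h k) ^- 2)%:E * (a (h k))%:E)%E).
    by apply: lee_wpmul2l; [rewrite lee_fin|exact: variance_K_ge].
  rewrite -EFinM lee_fin (_ : _ * _ = (a (h k))^-1); last first.
    by move: (an0 k); move: (a (h k)) => x x0; field.
  by rewrite lef_pV2 ?posrE.
apply: filterS (ae_cvg0_of_summable_integral P f mf f0 sumf) => w fw.
apply: (subsequence_ratio_cvg a a_incr a0 unb (fun n => K n r.+1 w)).
  by move=> n; exact: K_ge_incr.
apply/cvgrPdist_le => e e0.
have e20 : 0 < e ^+ 2 by rewrite exprn_gt0.
move/cvgrPdist_le: fw => /(_ _ e20); apply: filterS => k.
rewrite sub0r normrN ger0_norm// distrC /f -real_normK ?num_real//.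
by rewrite ler_pXn2r ?nnegrE// ltW.
Qed.

End StrongLaw.

(** * Consistency of the estimator *)

Theorem proposition5p1 (R : realType) (d : measure_display)
    (T : measurableType d) (P : probability T R)
    (p : nat -> R) (U : nat -> {RV P >-> nat}) (alpha : R)
    (hp : is_pmf p)
    (hU : iid_sample p U)
    (halpha : 0 < alpha <= 1)
    (hnu : regular_variation p alpha)
    (r : nat) (hr : (1 <= r)%N) :
  {ae P, forall w : T,
    r%:R * K_eq R (fun i => U i : T -> nat) n r w
      / K_ge R (fun i => U i : T -> nat) n r w @[n --> \oo] --> alpha}.
Proof.
case: r hr => // r _; case: hp => p0 p1; have /andP[alpha0 _] := halpha.
pose q j := p j.+1.
have qsum : (\sum_(j <oo) (q j)%:E = 1)%E.
  by rewrite -p1 (nneseries_shift1 (fun j => (p j)%:E))// => j /p0; rewrite lee_fin.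
have sq : nnsummable q by split; [move=> j; exact: p0|rewrite qsum ltry].
have q1 : sumR q = 1 by rewrite /sumR qsum.
have qinf := tail_count_unbounded p alpha alpha0 hnu sq.
have qscale l c : 0 < l -> 0 <= c -> c < l `^ alpha ->
    exists2 delta, 0 < delta & forall x, 0 < x -> x <= delta ->
      c * tail_count q x <= tail_count q (x / l).
  move=> l0 c0 cl; have [e e0 he] := tail_count_scale p alpha hnu sq l c l0 c0 cl.
  by exists e => // x x0 xe; case: (he x x0 xe).
have ratio := binom_sum_ratio_cvg q sq q1 qinf alpha alpha0 qscale r.
have unb s := binom_sum_unbounded q sq q1 qinf s.
have := K_ge_strong_law P p U hU sq q1 r.+1 (unb r.+1).
have := K_ge_strong_law P p U hU sq q1 r (unb r).
apply: filterS2 => w h1 h2.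
set K := K_ge R (fun i => U i : T -> nat) in h1 h2 *.
have rR : r.+1%:R != 0 :> R by rewrite pnatr_eq0.
(* The ratio of counts is factored through the means. The middle factor may tend to 0 (alpha = 1 and
   first order), but it stands only in a numerator. *)
have H : r.+1%:R * (1 - (K n r.+2 w / binom_sum q r.+2 n) *
    (binom_sum q r.+2 n / binom_sum q r.+1 n) /
    (K n r.+1 w / binom_sum q r.+1 n)) @[n --> \oo] -->
    r.+1%:R * (1 - 1 * (1 - alpha / r.+1%:R) / 1).
  apply: cvgM; first exact: cvg_cst.
  apply: cvgB; first exact: cvg_cst.
  by apply: cvgM; [exact: cvgM|apply: cvgV; rewrite ?oner_eq0].
have E : r.+1%:R * (1 - 1 * (1 - alpha / r.+1%:R) / 1) = alpha by field.
rewrite E in H; apply: cvg_trans H; apply: near_eq_cvg; near=> n.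
(* As division by 0 gives 0, a positive quotient certifies that the count and its mean are both
   nonzero. *)
have pos s : K n s.+1 w / binom_sum q s.+1 n > 0 ->
    K n s.+1 w != 0 /\ binom_sum q s.+1 n != 0.
  move=> h; split; apply: contraTneq h => ->; first by rewrite mul0r ltxx.
  by rewrite invr0 mulr0 ltxx.
have [k1 b1] : K n r.+1 w != 0 /\ binom_sum q r.+1 n != 0.
  by apply: pos; near: n; apply: (cvgr_gt _ h1); exact: ltr01.
have [k2 b2] : K n r.+2 w != 0 /\ binom_sum q r.+2 n != 0.
  by apply: pos; near: n; apply: (cvgr_gt _ h2); exact: ltr01.
rewrite K_eqE// -/K; field.
by rewrite k1 b1 b2.
Unshelve. all: by end_near. Qed.
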